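(* The locale $\mathbb{I}=[-1,1]$, with the midpoint operation $m(x,y)=\frac{x+y}{2}$ and endpoints $x_-=-1$ and $x_+=1$, is an interval object in the category $\mathbf{Loc}$ of locales. That is, $\mathbb{I}$ is an iterative midpoint algebra in $\mathbf{Loc}$, and for every iterative midpoint algebra $A$ in $\mathbf{Loc}$ with points $a_-,a_+\colon 1\to A$ there is a unique midpoint homomorphism $N\colon\mathbb{I}\to A$ that takes $-1$ to $a_-$ and $1$ to $a_+$.
   Context: $\mathbf{Loc}$ is the category of locales and locale maps (the opposite of the category of frames); a point of a locale $A$ is a map $1\to A$ from the terminal locale. $\mathbb{I}$ is the locale of Dedekind reals in the closed interval $[-1,1]$: its points are the Dedekind sections $(L,U)$ with $1\notin L$ and $-1\notin U$. In a category with finite products, a midpoint algebra is an object $A$ with a morphism $m\colon A\times A\to A$ satisfying (in terms of generalized elements) $m(x,x)=x$, $m(x,y)=m(y,x)$ and $m(m(x,y),m(z,w))=m(m(x,z),m(y,w))$. A (midpoint) homomorphism is a morphism preserving $m$. A midpoint algebra $A$ is iterative if for every object $X$ and all morphisms $h\colon X\to A$, $t\colon X\to X$ there is a unique morphism $M\colon X\to A$ with $M=m\circ(A\times M)\circ\langle h,t\rangle$, i.e. $M(x)=m(h(x),M(t(x)))$. *)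

(* Defs.v *)
From mathcomp Require Import all_boot all_order all_algebra.
From mathcomp Require Import boolp ring lra.

Set Implicit Arguments.
Unset Strict Implicit.
Unset Printing Implicit Defensive.

Import Order.TTheory GRing.Theory Num.Theory.
Local Open Scope ring_scope.

Record fpcategory := FPCategory {
  ob :> Type;
  hom : ob -> ob -> Type;
  idm : forall X, hom X X;
  compm : forall X Y Z, hom Y Z -> hom X Y -> hom X Z;
  terminal : ob;
  bang : forall X, hom X terminal;
  product : ob -> ob -> ob;
  fst_ : forall X Y, hom (product X Y) X;
  snd_ : forall X Y, hom (product X Y) Y;
  pairing : forall Z X Y, hom Z X -> hom Z Y -> hom Z (product X Y);
  comp_idl : forall X Y (f : hom X Y), compm (idm Y) f = f;
  comp_idr : forall X Y (f : hom X Y), compm f (idm X) = f;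
  comp_assoc : forall X Y Z W (f : hom Z W) (g : hom Y Z) (h : hom X Y),
    compm f (compm g h) = compm (compm f g) h;
  bang_unique : forall X (f : hom X terminal), f = bang X;
  fst_pairing : forall Z X Y (f : hom Z X) (g : hom Z Y),
    compm (fst_ X Y) (pairing f g) = f;
  snd_pairing : forall Z X Y (f : hom Z X) (g : hom Z Y),
    compm (snd_ X Y) (pairing f g) = g;
  pairing_unique : forall Z X Y (k : hom Z (product X Y)),
    k = pairing (compm (fst_ X Y) k) (compm (snd_ X Y) k)
}.

Arguments hom {C} X Y : rename.
Arguments idm {C} X : rename.
Arguments compm {C X Y Z} f g : rename.
Arguments terminal {C} : rename.
Arguments bang {C} X : rename.
Arguments product {C} X Y : rename.
Arguments fst_ {C X Y} : rename.
Arguments snd_ {C X Y} : rename.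
Arguments pairing {C Z X Y} f g : rename.

Declare Scope cat_scope.
Delimit Scope cat_scope with cat.
Bind Scope cat_scope with hom.
Notation "X ~> Y" := (hom X%_type Y%_type)
  (at level 99, Y at level 200, no associativity) : type_scope.
Notation "f \c g" := (compm f%cat g%cat)
  (at level 50, left associativity, format "f  \c  g") : cat_scope.
Notation "<| f , g |>" := (pairing f%cat g%cat)
  (at level 0, format "<| f ,  g |>") : cat_scope.

Definition product_map (C : fpcategory) (X X' Y Y' : C)
    (f : X ~> X') (g : Y ~> Y') : product X Y ~> product X' Y' :=
  (<| f \c fst_, g \c snd_ |>)%cat.

Definition midpoint_algebra (C : fpcategory) (A : C) (m : product A A ~> A) :=
  [/\ forall (X : C) (x : X ~> A), (m \c <| x, x |>)%cat = x,
      forall (X : C) (x y : X ~> A),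
        (m \c <| x, y |> = m \c <| y, x |>)%cat
    & forall (X : C) (x y z w : X ~> A),
        (m \c <| m \c <| x, y |>, m \c <| z, w |> |> =
         m \c <| m \c <| x, z |>, m \c <| y, w |> |>)%cat].

Definition midpoint_hom (C : fpcategory) (A : C) (m : product A A ~> A)
    (B : C) (n : product B B ~> B) (f : A ~> B) :=
  (f \c m = n \c product_map f f)%cat.

Definition iterative (C : fpcategory) (A : C) (m : product A A ~> A) :=
  forall (X : C) (h : X ~> A) (t : X ~> X),
  exists! M : X ~> A, (M = m \c product_map (idm A) M \c <| h, t |>)%cat.

Definition iterative_midpoint_algebra (C : fpcategory) (A : C)
    (m : product A A ~> A) := midpoint_algebra m /\ iterative m.

Definition interval_object (C : fpcategory) (I : C) (m : product I I ~> I)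
    (xm xp : terminal ~> I) :=
  iterative_midpoint_algebra m /\
  forall (A : C) (mA : product A A ~> A) (am ap : terminal ~> A),
  iterative_midpoint_algebra mA ->
  exists! N : I ~> A,
    [/\ midpoint_hom m mA N, (N \c xm)%cat = am & (N \c xp)%cat = ap].

Record frame := Frame {
  opens :> Type;
  fle : opens -> opens -> Prop;
  ftop : opens;
  fmeet : opens -> opens -> opens;
  fsup : (opens -> Prop) -> opens;
  fle_refl : forall x, fle x x;
  fle_trans : forall y x z, fle x y -> fle y z -> fle x z;
  fle_anti : forall x y, fle x y -> fle y x -> x = y;
  fle_top : forall x, fle x ftop;
  fle_meet : forall z x y, fle z (fmeet x y) <-> fle z x /\ fle z y;
  fsup_le : forall S y, fle (fsup S) y <-> (forall x, S x -> fle x y);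
  fmeet_sup : forall x S,
    fmeet x (fsup S) = fsup (fun z => exists2 s, S s & z = fmeet x s)
}.

Arguments ftop {f}.

Definition image_pred (A B : Type) (f : A -> B) (S : A -> Prop) : B -> Prop :=
  fun z => exists2 s, S s & z = f s.

(* A locale map X -> Y is a frame homomorphism from the opens of Y to those
   of X. *)
Record locmap (X Y : frame) := LocMap {
  invimage :> Y -> X;
  invimage_top : invimage ftop = ftop;
  invimage_meet : forall a b,
    invimage (fmeet a b) = fmeet (invimage a) (invimage b);
  invimage_sup : forall S, invimage (fsup S) = fsup (image_pred invimage S)
}.

Lemma locmap_ext (X Y : frame) (f g : locmap X Y) : f =1 g -> f = g.
Proof.
case: f => f f1 f2 f3; case: g => g g1 g2 g3 /= /funext E.
case: _ / E in g1 g2 g3 *.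
by rewrite (Prop_irrelevance f1 g1) (Prop_irrelevance f2 g2)
  (Prop_irrelevance f3 g3).
Qed.

Lemma fmeet_l (F : frame) (x y : F) : fle (fmeet x y) x.
Proof. by have [] := (fle_meet (fmeet x y) x y).1 (fle_refl _). Qed.

Lemma fmeet_r (F : frame) (x y : F) : fle (fmeet x y) y.
Proof. by have [] := (fle_meet (fmeet x y) x y).1 (fle_refl _). Qed.

Lemma fle_meetI (F : frame) (z x y : F) :
  fle z x -> fle z y -> fle z (fmeet x y).
Proof. by move=> *; apply/fle_meet. Qed.

Lemma fmeet_mono (F : frame) (x y x' y' : F) :
  fle x x' -> fle y y' -> fle (fmeet x y) (fmeet x' y').
Proof.
move=> xx yy; apply: fle_meetI.
  exact: fle_trans (fmeet_l x y) xx.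
exact: fle_trans (fmeet_r x y) yy.
Qed.

Lemma fmeetC (F : frame) (x y : F) : fmeet x y = fmeet y x.
Proof.
by apply: fle_anti; apply: fle_meetI; (exact: fmeet_l || exact: fmeet_r).
Qed.

Lemma fmeetA (F : frame) (x y z : F) :
  fmeet x (fmeet y z) = fmeet (fmeet x y) z.
Proof.
apply: fle_anti; do ?apply: fle_meetI.
- exact: fmeet_l.
- exact: fle_trans (fmeet_r _ _) (fmeet_l _ _).
- exact: fle_trans (fmeet_r _ _) (fmeet_r _ _).
- exact: fle_trans (fmeet_l _ _) (fmeet_l _ _).
- exact: fle_trans (fmeet_l _ _) (fmeet_r _ _).
- exact: fmeet_r.
Qed.

Lemma fmeetT (F : frame) (x : F) : fmeet x ftop = x.
Proof.
apply: fle_anti; first exact: fmeet_l.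
by apply: fle_meetI; [exact: fle_refl|exact: fle_top].
Qed.

Lemma fmeetTl (F : frame) (x : F) : fmeet ftop x = x.
Proof. by rewrite fmeetC fmeetT. Qed.

Lemma fle_sup (F : frame) (S : F -> Prop) (x : F) : S x -> fle x (fsup S).
Proof. by move=> Sx; apply: ((fsup_le S _).1 (fle_refl _)). Qed.

Lemma fsup_lub (F : frame) (S : F -> Prop) (y : F) :
  (forall x, S x -> fle x y) -> fle (fsup S) y.
Proof. by move/fsup_le. Qed.

Lemma fmeet_sup_le (F : frame) (x y : F) (S : F -> Prop) :
  (forall s, S s -> fle (fmeet x s) y) -> fle (fmeet x (fsup S)) y.
Proof.
by move=> H; rewrite fmeet_sup; apply: fsup_lub => z [s Ss ->]; apply: H.
Qed.

Lemma fsup_eq (F : frame) (S T : F -> Prop) :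
  (forall x, S x <-> T x) -> fsup S = fsup T.
Proof. by move=> H; congr fsup; apply: funext => x; apply: propext. Qed.

Lemma locmap_mono (X Y : frame) (f : locmap X Y) (a b : Y) :
  fle a b -> fle (f a) (f b).
Proof.
move=> ab.
have -> : a = fmeet a b.
  by apply: fle_anti (fmeet_l _ _); apply: fle_meetI => //; apply: fle_refl.
by rewrite invimage_meet; apply: fmeet_r.
Qed.

Definition locid (X : frame) : locmap X X.
Proof.
refine (@LocMap X X id _ _ _) => // S /=.
by apply: fsup_eq => x; split=> [Sx|[s Ss ->] //]; exists x.
Defined.

Definition loccomp (X Y Z : frame) (f : locmap Y Z) (g : locmap X Y) :
  locmap X Z.
Proof.
refine (@LocMap X Z (fun a => g (f a)) _ _ _) => [|a b|S].
- by rewrite !invimage_top.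
- by rewrite !invimage_meet.
- rewrite !invimage_sup; apply: fsup_eq => x; split.
    by move=> [_ [s Ss ->] ->]; exists s.
  by move=> [s Ss ->]; exists (f s) => //; exists s.
Defined.

(* A meet-semilattice (up to the equivalence of its preorder) with a family of
   basic covers.  Covers are not required to be stable under meets: stability
   is built into the notion of saturated set below. *)
Record site := Site {
  base :> Type;
  sle : base -> base -> Prop;
  stop : base;
  smeet : base -> base -> base;
  scov : base -> (base -> Prop) -> Prop;
  sle_refl : forall x, sle x x;
  sle_trans : forall y x z, sle x y -> sle y z -> sle x z;
  sle_top : forall x, sle x stop;
  sle_meet : forall z x y, sle z (smeet x y) <-> sle z x /\ sle z y
}.

Arguments stop {s}.

Record saturated (S : site) (U : S -> Prop) : Prop := Saturated {
  sat_down : forall x y, sle x y -> U y -> U x;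
  sat_cov : forall a K, scov a K ->
    forall s, (forall c, K c -> U (smeet s c)) -> U (smeet s a)
}.

Definition sat_opens (S : site) := {U : S -> Prop | saturated U}.

Definition sat_closure (S : site) (W : S -> Prop) : S -> Prop :=
  fun s => forall U, saturated U -> (forall t, W t -> U t) -> U s.

Lemma sat_closureP (S : site) (W : S -> Prop) : saturated (sat_closure W).
Proof.
split=> [x y xy Wy U satU WU|a K aK s H U satU WU].
  exact: (sat_down satU xy (Wy _ satU WU)).
by apply: (sat_cov satU aK) => c Kc; apply: (H c Kc U).
Qed.

Lemma smeet_l (S : site) (x y : S) : sle (smeet x y) x.
Proof. by have [] := (sle_meet (smeet x y) x y).1 (sle_refl _). Qed.

Lemma smeet_r (S : site) (x y : S) : sle (smeet x y) y.
Proof. by have [] := (sle_meet (smeet x y) x y).1 (sle_refl _). Qed.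

Lemma sle_meetI (S : site) (z x y : S) :
  sle z x -> sle z y -> sle z (smeet x y).
Proof. by move=> *; apply/sle_meet. Qed.

Lemma smeetA1 (S : site) (x y z : S) :
  sle (smeet (smeet x y) z) (smeet x (smeet y z)).
Proof.
do ?apply: sle_meetI.
- exact: sle_trans (smeet_l _ _) (smeet_l _ _).
- exact: sle_trans (smeet_l _ _) (smeet_r _ _).
- exact: smeet_r.
Qed.

Lemma smeetA2 (S : site) (x y z : S) :
  sle (smeet x (smeet y z)) (smeet (smeet x y) z).
Proof.
do ?apply: sle_meetI.
- exact: smeet_l.
- exact: sle_trans (smeet_r _ _) (smeet_l _ _).
- exact: sle_trans (smeet_r _ _) (smeet_r _ _).
Qed.

Lemma sat_inter (S : site) (U V : S -> Prop) :
  saturated U -> saturated V -> saturated (fun s => U s /\ V s).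
Proof.
move=> sU sV; split=> [x y xy [Uy Vy]|a K aK s H].
  by split; [apply: (sat_down sU xy Uy)|apply: (sat_down sV xy Vy)].
by split; [apply: (sat_cov sU aK)|apply: (sat_cov sV aK)] => c /H [].
Qed.

Lemma sat_residual (S : site) (W V : S -> Prop) : saturated V ->
  saturated (fun x => forall u, W u -> V (smeet u x)).
Proof.
move=> sV; split=> [x y xy H u Wu|a K aK s H u Wu].
  apply: (sat_down sV _ (H u Wu)); apply: sle_meetI; first exact: smeet_l.
  exact: sle_trans (smeet_r _ _) xy.
apply: (sat_down sV (smeetA2 _ _ _)).
apply: (sat_cov sV aK) => c Kc.
exact: (sat_down sV (smeetA1 _ _ _) (H c Kc u Wu)).
Qed.

Definition sat_of (S : site) (W : S -> Prop) : sat_opens S :=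
  exist _ (sat_closure W) (sat_closureP W).

Definition sat_le (S : site) (U V : sat_opens S) :=
  forall s, sval U s -> sval V s.

Lemma sat_topP (S : site) : saturated (fun _ : S => True).
Proof. by split. Qed.

Definition sat_top (S : site) : sat_opens S := exist _ _ (sat_topP S).

Definition sat_meet (S : site) (U V : sat_opens S) : sat_opens S :=
  exist _ _ (sat_inter (svalP U) (svalP V)).

Definition sat_sup (S : site) (P : sat_opens S -> Prop) : sat_opens S :=
  sat_of (fun s => exists2 U, P U & sval U s).

Lemma sat_ext (S : site) (U V : sat_opens S) :
  (forall s, sval U s <-> sval V s) -> U = V.
Proof.
case: U V => [U sU] [V sV] /= UV; apply: eq_exist.
by apply: funext => s; apply: propext.
Qed.

Lemma sat_le_anti (S : site) (U V : sat_opens S) :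
  sat_le U V -> sat_le V U -> U = V.
Proof. by move=> UV VU; apply: sat_ext => s; split; [apply: UV|apply: VU]. Qed.

Lemma sat_le_meet (S : site) (Z U V : sat_opens S) :
  sat_le Z (sat_meet U V) <-> sat_le Z U /\ sat_le Z V.
Proof.
split=> [H|[H1 H2] s Zs]; first by split=> s /H [].
by split; [apply: H1|apply: H2].
Qed.

Lemma sat_sup_le (S : site) (P : sat_opens S -> Prop) (V : sat_opens S) :
  sat_le (sat_sup P) V <-> (forall U, P U -> sat_le U V).
Proof.
split=> [H U PU s Us|H s Hs].
  by apply: H => W sW; apply; exists U.
by apply: (Hs _ (svalP V)) => t [U PU]; apply: H.
Qed.

Lemma sat_meet_sup (S : site) (U : sat_opens S) (P : sat_opens S -> Prop) :
  sat_meet U (sat_sup P) =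
  sat_sup (fun Z => exists2 V, P V & Z = sat_meet U V).
Proof.
apply: sat_le_anti => [x [Ux Px]|]; last first.
  apply/sat_sup_le => _ [V PV ->]; apply/sat_le_meet; split=> s [Us Vs] //.
  by move=> W _; apply; exists V.
move=> W sW HW.
have /(_ x Ux) : forall u, sval U u -> W (smeet u x).
  apply: (Px _ (sat_residual (sval U) sW)) => v [V PV Vv] u Uu.
  apply: HW; exists (sat_meet U V); first by exists V.
  split; first exact: (sat_down (svalP U) (smeet_l _ _) Uu).
  exact: (sat_down (svalP V) (smeet_r _ _) Vv).
by apply: (sat_down sW); apply: sle_meetI; apply: sle_refl.
Qed.

Definition site_frame (S : site) : frame.
Proof.
refine (@Frame (sat_opens S) (@sat_le S) (sat_top S) (@sat_meet S)
          (@sat_sup S) _ _ (@sat_le_anti S) _ (@sat_le_meet S)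
          (@sat_sup_le S) (@sat_meet_sup S)).
- by move=> U s.
- by move=> V U W UV VW s /UV /VW.
- by move=> U s.
Defined.

Definition principal (S : site) (s : S) : site_frame S :=
  sat_of (fun t => t = s).

Record flat_map (S : site) (F : frame) (h : S -> F) : Prop := FlatMap {
  flat_mono : forall x y, sle x y -> fle (h x) (h y);
  flat_top : h stop = ftop;
  flat_meet : forall x y, h (smeet x y) = fmeet (h x) (h y);
  flat_cov : forall a K, scov a K -> fle (h a) (fsup (image_pred h K))
}.

Lemma flat_sat (S : site) (F : frame) (h : S -> F) (z : F) :
  flat_map h -> saturated (fun s => fle (h s) z).
Proof.
move=> fh; split=> [x y /(flat_mono fh)|a K aK s H]; first exact: fle_trans.
rewrite flat_meet //.
apply: fle_trans (fmeet_mono (fle_refl _) (flat_cov fh aK)) _.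
by apply: fmeet_sup_le => _ [c Kc ->]; rewrite -flat_meet //; apply: H.
Qed.

Definition site_ext_fun (S : site) (F : frame) (h : S -> F)
  (U : site_frame S) : F := fsup (image_pred h (sval U)).

Definition site_ext (S : site) (F : frame) (h : S -> F) (fh : flat_map h) :
  locmap F (site_frame S).
Proof.
refine (@LocMap F (site_frame S) (site_ext_fun h) _ _ _).
- apply: fle_anti; first exact: fle_top.
  by rewrite -(flat_top fh); apply: fle_sup; exists stop.
- move=> U V; apply: fle_anti.
    apply: fsup_lub => _ [s [Us Vs] ->].
    by apply: fle_meetI; apply: fle_sup; exists s.
  apply: fmeet_sup_le => _ [v Vv ->]; rewrite fmeetC.
  apply: fmeet_sup_le => _ [u Uu ->]; rewrite -flat_meet //.
  apply: fle_sup; exists (smeet v u) => //; split.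
    exact: (sat_down (svalP U) (smeet_r _ _) Uu).
  exact: (sat_down (svalP V) (smeet_l _ _) Vv).
- move=> P; apply: fle_anti; apply: fsup_lub.
    move=> _ [s Ps ->]; apply: (Ps _ (flat_sat _ fh)) => t [U PU Ut].
    apply: (@fle_trans _ (site_ext_fun h U)); first by apply: fle_sup; exists t.
    by apply: fle_sup; exists U.
  move=> _ [U PU ->]; apply: fsup_lub => _ [s Us ->].
  by apply: fle_sup; exists s => //= W sW; apply; exists U.
Defined.

Lemma site_ext_principal (S : site) (F : frame) (h : S -> F)
  (fh : flat_map h) (s : S) : site_ext fh (principal s) = h s.
Proof.
apply: fle_anti.
  apply: fsup_lub => _ [t Ht ->]; apply: (Ht _ (flat_sat _ fh)) => _ ->.
  exact: fle_refl.
by apply: fle_sup; exists s => // U _; apply.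
Qed.

Lemma principal_self (S : site) (s : S) : sval (principal s) s.
Proof. by move=> U _; apply. Qed.

Arguments principal_self {S} s.

Lemma principal_le (S : site) (s : S) (U : site_frame S) :
  fle (principal s) U <-> sval U s.
Proof.
split=> [|Us t Ht]; first by apply; apply: principal_self.
by apply: (Ht _ (svalP U)) => _ ->.
Qed.

Lemma sup_principal (S : site) (U : site_frame S) :
  U = fsup (image_pred (@principal S) (sval U)).
Proof.
apply: fle_anti.
  move=> s Us; apply/principal_le; apply: fle_sup; by exists s.
by apply: fsup_lub => _ [s Us ->]; apply/principal_le.
Qed.

Lemma principal_flat (S : site) : flat_map (@principal S).
Proof.
have mono (x y : S) : sle x y -> fle (principal x) (principal y).
  move=> xy; apply/principal_le.
  exact: (sat_down (svalP (principal y)) xy (principal_self _)).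
split=> //.
- apply: fle_anti; first exact: fle_top.
  move=> s _; apply: (sat_down (svalP (principal _)) (sle_top s) _).
  exact: principal_self.
- move=> x y; apply: fle_anti.
    by apply: fle_meetI; apply: mono; [apply: smeet_l|apply: smeet_r].
  move=> s [Hx Hy].
  have sP := svalP (principal (smeet x y)).
  have : sval (principal (smeet x y)) (smeet s s).
    have H u : u = x -> sval (principal (smeet x y)) (smeet u s).
      move=> ->; apply: (Hy _ (sat_residual (fun t => t = x) sP)) => //.
      by move=> _ -> _ ->; apply: principal_self.
    have := Hx _ (sat_residual (fun t => t = s) sP).
    apply=> // _ -> _ ->.
    apply: (sat_down sP _ (H x erefl)).
    by apply: sle_meetI; [apply: smeet_r|apply: smeet_l].
  by apply: (sat_down sP); apply: sle_meetI; apply: sle_refl.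
- move=> a K aK; apply/principal_le.
  set V := fsup _; have sV := svalP V.
  apply: (@sat_down _ _ sV _ (smeet a a)).
    by apply: sle_meetI; apply: sle_refl.
  apply: (sat_cov sV aK) => c Kc.
  apply: (sat_down sV (smeet_r _ _) _).
  by apply/principal_le; apply: fle_sup; exists c.
Qed.

Lemma locmap_site_ext (S : site) (X : frame) (f g : locmap X (site_frame S)) :
  (forall s, f (principal s) = g (principal s)) -> f = g.
Proof.
move=> fg; apply: locmap_ext => U.
rewrite (sup_principal U) !invimage_sup; apply: fsup_eq => x.
by split=> -[_ [s Us ->] ->]; exists (principal s);
  rewrite ?fg //; exists s.
Qed.

(* The terminal locale: its frame is the frame of truth values. *)
Definition loc1 : frame.
Proof.
refine (@Frame Prop (fun p q => p -> q) True and
          (fun S => exists2 p, S p & p) _ _ _ _ _ _ _).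
- by [].
- by move=> q p r pq qr /pq /qr.
- by move=> p q pq qp; apply: propext.
- by [].
- by move=> r p q; split=> [H|[H1 H2] r0]; [split=> /H []|split; auto].
- move=> S q; split=> [H p Sp p0|H [p Sp p0]]; last exact: H Sp p0.
  by apply: H; exists p.
- move=> p S; apply: propext; split.
    by move=> [p0 [q Sq q0]]; exists (p /\ q) => //; exists q.
  by move=> [_ [q Sq ->] [p0 q0]]; split=> //; exists q.
Defined.

Definition locbang (X : frame) : locmap X loc1.
Proof.
refine (@LocMap X loc1 (fun p : Prop => fsup (fun z : X => p /\ z = ftop))
          _ _ _).
- by apply: fle_anti; [apply: fle_top|apply: fle_sup].
- move=> p q; apply: fle_anti.
    by apply: fsup_lub => _ [[p0 q0] ->]; apply: fle_meetI; apply: fle_sup.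
  apply: fmeet_sup_le => _ [q0 ->]; rewrite fmeetT.
  by apply: fsup_lub => _ [p0 ->]; apply: fle_sup.
- move=> S; apply: fle_anti; apply: fsup_lub.
    move=> _ [[p Sp p0] ->].
    apply: (@fle_trans _ (fsup (fun z : X => p /\ z = ftop))).
      exact: fle_sup.
    by apply: fle_sup; exists p.
  move=> _ [p Sp ->]; apply: fsup_lub => _ [p0 ->].
  by apply: fle_sup; split=> //; exists p.
Defined.

Lemma locbang_unique (X : frame) (f : locmap X loc1) : f = locbang X.
Proof.
apply: locmap_ext => p.
have -> : p = fsup (fun q : loc1 => p /\ q = ftop).
  by apply: propext; split=> [p0|[_ [p0 ->]] //]; exists True.
rewrite !invimage_sup; apply: fsup_eq => x.
by split=> -[q [p0 ->] ->]; exists ftop; rewrite ?invimage_top.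
Qed.

(* The frame coproduct of the opens of X and Y, as sets of rectangles (a, b)
   that are closed under joins in each argument. *)
Inductive product_cov (X Y : frame) : X * Y -> (X * Y -> Prop) -> Prop :=
| product_cov_l (S : X -> Prop) (b : Y) :
    product_cov (fsup S, b) (image_pred (fun s => (s, b)) S)
| product_cov_r (a : X) (S : Y -> Prop) :
    product_cov (a, fsup S) (image_pred (fun s => (a, s)) S).

Definition product_site (X Y : frame) : site.
Proof.
refine (@Site (X * Y)%type (fun p q => fle p.1 q.1 /\ fle p.2 q.2)
          (ftop, ftop) (fun p q => (fmeet p.1 q.1, fmeet p.2 q.2))
          (@product_cov X Y) _ _ _ _).
- by move=> p; split; apply: fle_refl.
- move=> q p r [pq1 pq2] [qr1 qr2].
  by split; [apply: fle_trans pq1 qr1|apply: fle_trans pq2 qr2].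
- by move=> p; split; apply: fle_top.
- move=> r p q /=; rewrite !fle_meet; tauto.
Defined.

Definition locprod (X Y : frame) : frame := site_frame (product_site X Y).

Definition rect (X Y : frame) (a : X) (b : Y) : locprod X Y :=
  principal ((a, b) : product_site X Y).

Definition locfst (X Y : frame) : locmap (locprod X Y) X.
Proof.
refine (@LocMap (locprod X Y) X (fun a => rect a ftop) _ _ _).
- exact: (flat_top (principal_flat (product_site X Y))).
- move=> a b; rewrite /rect -(flat_meet (principal_flat _)) /=.
  by rewrite fmeetT.
- move=> S; apply: fle_anti.
    have := flat_cov (principal_flat (product_site X Y))
      (product_cov_l S ftop).
    congr fle; apply: fsup_eq => x; split.
      by move=> [_ [s Ss ->] ->]; exists s.
    by move=> [s Ss ->]; exists (s, ftop) => //; exists s.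
  apply: fsup_lub => _ [s Ss ->].
  apply: (flat_mono (principal_flat (product_site X Y))).
  by split; [apply: fle_sup|apply: fle_refl].
Defined.

Definition locsnd (X Y : frame) : locmap (locprod X Y) Y.
Proof.
refine (@LocMap (locprod X Y) Y (fun b => rect ftop b) _ _ _).
- exact: (flat_top (principal_flat (product_site X Y))).
- move=> a b; rewrite /rect -(flat_meet (principal_flat _)) /=.
  by rewrite fmeetT.
- move=> S; apply: fle_anti.
    have := flat_cov (principal_flat (product_site X Y))
      (product_cov_r ftop S).
    congr fle; apply: fsup_eq => x; split.
      by move=> [_ [s Ss ->] ->]; exists s.
    by move=> [s Ss ->]; exists (ftop, s) => //; exists s.
  apply: fsup_lub => _ [s Ss ->].
  apply: (flat_mono (principal_flat (product_site X Y))).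
  by split; [apply: fle_refl|apply: fle_sup].
Defined.

Lemma rectE (X Y : frame) (a : X) (b : Y) :
  rect a b = fmeet (locfst X Y a) (locsnd X Y b).
Proof.
have := flat_meet (principal_flat (product_site X Y)) (a, ftop) (ftop, b).
by rewrite [smeet _ _]/= fmeetT fmeetTl.
Qed.

Lemma locpair_flat (Z X Y : frame) (f : locmap Z X) (g : locmap Z Y) :
  flat_map (fun p : product_site X Y => fmeet (f p.1) (g p.2)).
Proof.
split.
- by move=> x y [xy1 xy2]; apply: fmeet_mono; apply: locmap_mono.
- by rewrite /= !invimage_top fmeetT.
- move=> x y /=; rewrite !invimage_meet -!fmeetA; congr fmeet.
  by rewrite fmeetA [fmeet _ (g x.2)]fmeetC -fmeetA.
- move=> _ _ [S b|a S] /=.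
    rewrite invimage_sup fmeetC; apply: fmeet_sup_le => _ [s Ss ->].
    apply: fle_sup; exists (s, b); first by exists s.
    by rewrite fmeetC.
  rewrite invimage_sup; apply: fmeet_sup_le => _ [s Ss ->].
  by apply: fle_sup; exists (a, s); first by exists s.
Qed.

Definition locpair (Z X Y : frame) (f : locmap Z X) (g : locmap Z Y) :
  locmap Z (locprod X Y) := site_ext (locpair_flat f g).

Lemma locpair_rect (Z X Y : frame) (f : locmap Z X) (g : locmap Z Y)
  (a : X) (b : Y) : locpair f g (rect a b) = fmeet (f a) (g b).
Proof. exact: site_ext_principal. Qed.

Definition Loc : fpcategory.
Proof.
refine (@FPCategory frame locmap locid loccomp loc1 locbang locprod locfst
          locsnd locpair _ _ _ locbang_unique _ _ _).
- by move=> *; apply: locmap_ext.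
- by move=> *; apply: locmap_ext.
- by move=> *; apply: locmap_ext.
- move=> Z X Y f g; apply: locmap_ext => a.
  rewrite [LHS](locpair_rect f g); by rewrite invimage_top fmeetT.
- move=> Z X Y f g; apply: locmap_ext => a.
  rewrite [LHS](locpair_rect f g); by rewrite invimage_top fmeetTl.
- move=> Z X Y k; apply: locmap_site_ext => -[a b].
  rewrite -[principal _]/(rect a b) locpair_rect rectE invimage_meet.
  by [].
Defined.

(* A set of axioms  g1 /\ ... /\ gn |- \/ K, where each element of K is again
   a finite conjunction; finite conjunctions of generators are sequences. *)
Definition geometric_theory (G : Type) := seq G -> (seq G -> Prop) -> Prop.

Definition theory_site (G : Type) (T : geometric_theory G) : site.
Proof.
refine (@Site (seq G) (fun k l => forall g, List.In g l -> List.In g k)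
          [::] cat T _ _ _ _).
- by [].
- by move=> l k n kl ln g /ln /kl.
- by [].
- move=> n k l; split=> [H|[H1 H2] g /(@List.in_app_or _ _ _ _) [/H1|/H2] //].
  by split=> g gk; apply: H; apply/List.in_or_app; [left|right].
Defined.

(* The locale whose points are the models of T: generators G, relations T. *)
Definition classifying_locale (G : Type) (T : geometric_theory G) : frame :=
  site_frame (theory_site T).

Definition generator (G : Type) (T : geometric_theory G) (g : G) :
  classifying_locale T := principal ([:: g] : theory_site T).

Definition fconj (G : Type) (F : frame) (h : G -> F) (l : seq G) : F :=
  foldr (fun g => fmeet (h g)) ftop l.

Definition model (G : Type) (T : geometric_theory G) (F : frame)
    (h : G -> F) : Prop :=
  forall l K, T l K -> fle (fconj h l) (fsup (image_pred (fconj h) K)).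

Lemma fle_conj (G : Type) (F : frame) (h : G -> F) (l : seq G) (z : F) :
  fle z (fconj h l) <-> (forall g, List.In g l -> fle z (h g)).
Proof.
elim: l => [|g l IH] /=; first by split=> // _; apply: fle_top.
rewrite fle_meet IH; split=> [[H1 H2] k [<- //|/H2 //]|H].
by split=> [|k kl]; apply: H; [left|right].
Qed.

Lemma model_flat (G : Type) (T : geometric_theory G) (F : frame)
  (h : G -> F) : model T h -> flat_map (fconj h : theory_site T -> F).
Proof.
move=> Th; split=> //.
  move=> k l kl; apply/fle_conj => g /kl.
  by move: g; apply/fle_conj; apply: fle_refl.
by move=> k l /=; elim: k => [|g k IH] /=; rewrite ?fmeetTl // IH fmeetA.
Qed.

Definition classify (G : Type) (T : geometric_theory G) (X : frame)
  (h : G -> X) (Th : model T h) : locmap X (classifying_locale T) :=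
  site_ext (model_flat Th).

Lemma classifyE (G : Type) (T : geometric_theory G) (X : frame)
  (h : G -> X) (Th : model T h) (g : G) : classify Th (generator T g) = h g.
Proof. by rewrite /classify site_ext_principal /= fmeetT. Qed.

Lemma principal_conj (G : Type) (T : geometric_theory G) (l : seq G) :
  principal (l : theory_site T) = fconj (generator T) l.
Proof.
have flatT := principal_flat (theory_site T).
elim: l => [|g l IH]; first exact: (flat_top flatT).
rewrite -[RHS]/(fmeet (generator T g) (fconj (generator T) l)) -IH.
exact: (flat_meet flatT [:: g] l).
Qed.

Lemma invimage_conj (G : Type) (X Y : frame) (f : locmap X Y) (h : G -> Y)
  (l : seq G) : f (fconj h l) = fconj (fun g => f (h g)) l.
Proof.
by elim: l => [|g l IH] /=; rewrite ?invimage_top // invimage_meet IH.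
Qed.

Lemma locmap_classifying_ext (G : Type) (T : geometric_theory G) (X : frame)
  (f g : locmap X (classifying_locale T)) :
  (forall a, f (generator T a) = g (generator T a)) -> f = g.
Proof.
move=> fg; apply: locmap_site_ext => l.
rewrite principal_conj !invimage_conj; congr fconj; exact: funext.
Qed.

Lemma locmap_model (G : Type) (T : geometric_theory G) (X : frame)
  (f : locmap X (classifying_locale T)) :
  model T (fun a => f (generator T a)).
Proof.
move=> l K TlK; rewrite -invimage_conj -principal_conj.
have /(locmap_mono f) := flat_cov (principal_flat (theory_site T)) TlK.
move=> /fle_trans; apply.
rewrite invimage_sup; apply: fsup_lub => _ [_ [k Kk ->] ->].
apply: fle_sup; exists k => //.
by rewrite -invimage_conj -principal_conj.
Qed.

(* The generators are the propositions q \in L and q \in U. *)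
Inductive section_gen := inL of rat | inU of rat.

Inductive section_theory : geometric_theory section_gen :=
| L_inhabited : section_theory [::] (fun k => exists q, k = [:: inL q])
| U_inhabited : section_theory [::] (fun k => exists q, k = [:: inU q])
| L_lower q r : q < r -> section_theory [:: inL r] (fun k => k = [:: inL q])
| U_upper q r : q < r -> section_theory [:: inU q] (fun k => k = [:: inU r])
| L_rounded q : section_theory [:: inL q]
    (fun k => exists2 r, q < r & k = [:: inL r])
| U_rounded r : section_theory [:: inU r]
    (fun k => exists2 q, q < r & k = [:: inU q])
| LU_disjoint q : section_theory [:: inL q; inU q] (fun _ => False)
| LU_located q r : q < r ->
    section_theory [::] (fun k => k = [:: inL q] \/ k = [:: inU r])
| L_bound : section_theory [:: inL 1] (fun _ => False)
| U_bound : section_theory [:: inU (-1)] (fun _ => False).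

Definition II : Loc := classifying_locale section_theory.

(* The section of the rational c, as a model in the frame of truth values. *)
Definition rat_section (c : rat) (g : section_gen) : loc1 :=
  match g with inL q => q < c | inU q => c < q end.

Lemma rat_sectionP (c : rat) : -1 <= c <= 1 ->
  model section_theory (rat_section c).
Proof.
move=> /andP[c1 c2] l K [] /=.
- move=> _; exists (c - 1 < c) => //; last lra.
  exists [:: inL (c - 1)]; first by eexists.
  by apply: propext => /=; split=> [|[]].
- move=> _; exists (c < c + 1) => //; last lra.
  exists [:: inU (c + 1)]; first by eexists.
  by apply: propext => /=; split=> [|[]].
- move=> q r qr [rc _]; exists (q < c); last lra.
  by eexists; first reflexivity; apply: propext => /=; split=> [|[]].
- move=> q r qr [rc _]; exists (c < r); last lra.
  by eexists; first reflexivity; apply: propext => /=; split=> [|[]].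
- move=> q [qc _]; exists ((q + c) / 2%:R < c); last lra.
  exists [:: inL ((q + c) / 2%:R)]; first by eexists; last reflexivity; lra.
  by apply: propext => /=; split=> [|[]].
- move=> q [qc _]; exists (c < (q + c) / 2%:R); last lra.
  exists [:: inU ((q + c) / 2%:R)]; first by eexists; last reflexivity; lra.
  by apply: propext => /=; split=> [|[]].
- move=> q [qc [cq _]]; lra.
- move=> q r qr _; have [qc|cq] := ltP q c.
    exists (q < c) => //; exists [:: inL q]; first by left.
    by apply: propext => /=; split=> [|[]].
  exists (c < r); last lra.
  exists [:: inU r]; first by right.
  by apply: propext => /=; split=> [|[]].
- case; lra.
- case; lra.
Qed.

Definition rat_point (c : rat) (hc : -1 <= c <= 1) : terminal ~> II :=
  classify (rat_sectionP hc) : locmap loc1 _.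

Lemma minus_one_bounds : -1 <= (-1 : rat) <= 1. Proof. lra. Qed.
Lemma plus_one_bounds : -1 <= (1 : rat) <= 1. Proof. lra. Qed.

Definition minus_one : terminal ~> II := rat_point minus_one_bounds.
Definition plus_one : terminal ~> II := rat_point plus_one_bounds.

(* q < (x + y) / 2 iff q = (r + s) / 2 for some r < x and s < y, and dually. *)
Definition mid_section (F : frame) (x y : section_gen -> F)
    (g : section_gen) : F :=
  match g with
  | inL q => fsup (fun z => exists r s,
      (r + s) / 2%:R = q /\ z = fmeet (x (inL r)) (y (inL s)))
  | inU q => fsup (fun z => exists r s,
      (r + s) / 2%:R = q /\ z = fmeet (x (inU r)) (y (inU s)))
  end.

Lemma model_elim (G : Type) (T : geometric_theory G) (F : frame)
  (h : G -> F) (l : seq G) (K : seq G -> Prop) (w z : F) :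
  model T h -> T l K -> (forall k, K k -> fle (fmeet w (fconj h k)) z) ->
  fle (fmeet w (fconj h l)) z.
Proof.
move=> Th TlK H; apply: fle_trans (fmeet_mono (fle_refl w) (Th _ _ TlK)) _.
by apply: fmeet_sup_le => _ [k Kk ->]; apply: H.
Qed.

Lemma section_L_mono (F : frame) (x : section_gen -> F) (q r : rat) :
  model section_theory x -> q <= r -> fle (x (inL r)) (x (inL q)).
Proof.
move=> mx; rewrite le_eqVlt => /predU1P[->|qr]; first exact: fle_refl.
have := model_elim (w := ftop) (z := x (inL q)) mx (L_lower qr).
rewrite /= fmeetTl fmeetT; apply=> _ ->.
by rewrite /= fmeetTl fmeetT; apply: fle_refl.
Qed.

Lemma section_U_mono (F : frame) (x : section_gen -> F) (q r : rat) :
  model section_theory x -> q <= r -> fle (x (inU q)) (x (inU r)).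
Proof.
move=> mx; rewrite le_eqVlt => /predU1P[->|qr]; first exact: fle_refl.
have := model_elim (w := ftop) (z := x (inU r)) mx (U_upper qr).
rewrite /= fmeetTl fmeetT; apply=> _ ->.
by rewrite /= fmeetTl fmeetT; apply: fle_refl.
Qed.

Lemma section_L_rounded (F : frame) (x : section_gen -> F) (q : rat)
  (w z : F) : model section_theory x ->
  (forall r, q < r -> fle (fmeet w (x (inL r))) z) ->
  fle (fmeet w (x (inL q))) z.
Proof.
move=> mx H; have := model_elim (w := w) (z := z) mx (L_rounded q).
by rewrite /= fmeetT; apply=> _ [r qr ->]; rewrite /= fmeetT; apply: H.
Qed.

Lemma section_U_rounded (F : frame) (x : section_gen -> F) (r : rat)
  (w z : F) : model section_theory x ->
  (forall q, q < r -> fle (fmeet w (x (inU q))) z) ->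
  fle (fmeet w (x (inU r))) z.
Proof.
move=> mx H; have := model_elim (w := w) (z := z) mx (U_rounded r).
by rewrite /= fmeetT; apply=> _ [q qr ->]; rewrite /= fmeetT; apply: H.
Qed.

Lemma section_disjoint (F : frame) (x : section_gen -> F) (q r : rat)
  (z : F) : model section_theory x -> r <= q ->
  fle (fmeet (x (inL q)) (x (inU r))) z.
Proof.
move=> mx rq.
apply: fle_trans (fmeet_mono (section_L_mono mx rq) (fle_refl _)) _.
have := model_elim (w := ftop) (z := z) mx (LU_disjoint r).
by rewrite /= fmeetTl fmeetT; apply.
Qed.

Lemma section_located (F : frame) (x : section_gen -> F) (q r : rat)
  (w z : F) : model section_theory x -> q < r ->
  fle (fmeet w (x (inL q))) z -> fle (fmeet w (x (inU r))) z -> fle w z.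
Proof.
move=> mx qr H1 H2; have := model_elim (w := w) (z := z) mx (LU_located qr).
by rewrite /= fmeetT; apply=> _ [] ->; rewrite /= fmeetT.
Qed.

Lemma section_L_bound (F : frame) (x : section_gen -> F) (q : rat) (z : F) :
  model section_theory x -> 1 <= q -> fle (x (inL q)) z.
Proof.
move=> mx q1; apply: fle_trans (section_L_mono mx q1) _.
have := model_elim (w := ftop) (z := z) mx L_bound.
by rewrite /= fmeetT fmeetTl; apply.
Qed.

Lemma section_U_bound (F : frame) (x : section_gen -> F) (q : rat) (z : F) :
  model section_theory x -> q <= -1 -> fle (x (inU q)) z.
Proof.
move=> mx q1; apply: fle_trans (section_U_mono mx q1) _.
have := model_elim (w := ftop) (z := z) mx U_bound.
by rewrite /= fmeetT fmeetTl; apply.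
Qed.

(* A section is covered by rational intervals of any given length. *)
Lemma section_interval (F : frame) (x : section_gen -> F) (e : rat) (z : F) :
  model section_theory x -> 0 < e ->
  (forall u, fle (fmeet (x (inL u)) (x (inU (u + e)))) z) -> fle ftop z.
Proof.
move=> mx e0 H.
have step (n : nat) (c : rat) :
    1 <= c + n%:R * (e / 2%:R) -> fle (x (inL c)) z.
  elim: n c => [|n IH] c.
    by rewrite mul0r addr0; apply: section_L_bound.
  rewrite -natr1 => hc.
  have c_lt : c + e / 2%:R < c + e by lra.
  apply: (section_located mx c_lt); last exact: H.
  by apply: fle_trans (fmeet_r _ _) _; apply: IH; lra.
have lt21 : (-2%:R : rat) < -1 by lra.
apply: (section_located mx lt21); rewrite fmeetTl; last first.
  exact: section_U_bound.
have e2 : 0 < e / 2%:R by lra.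
apply: (step (Num.bound (3%:R / (e / 2%:R)))).
have : 3%:R / (e / 2%:R) < (Num.bound (3%:R / (e / 2%:R)))%:R.
  by apply: archi_boundP; apply: divr_ge0; lra.
rewrite ltr_pdivrMr //; lra.
Qed.

Lemma mid_L_le (F : frame) (x y : section_gen -> F) (r s q : rat) :
  (r + s) / 2%:R = q ->
  fle (fmeet (x (inL r)) (y (inL s))) (mid_section x y (inL q)).
Proof. by move=> rs; apply: fle_sup; exists r, s. Qed.

Lemma mid_U_le (F : frame) (x y : section_gen -> F) (r s q : rat) :
  (r + s) / 2%:R = q ->
  fle (fmeet (x (inU r)) (y (inU s))) (mid_section x y (inU q)).
Proof. by move=> rs; apply: fle_sup; exists r, s. Qed.

Lemma fle_sup_conj1 (G : Type) (F : frame) (h : G -> F)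
  (K : seq G -> Prop) (g : G) :
  K [:: g] -> fle (h g) (fsup (image_pred (fconj h) K)).
Proof. by move=> Kg; apply: fle_sup; exists [:: g] => //=; rewrite fmeetT. Qed.

Lemma mid_sectionP (F : frame) (x y : section_gen -> F) :
  model section_theory x -> model section_theory y ->
  model section_theory (mid_section x y).
Proof.
move=> mx my l K T; set z := fsup _.
have le1 (w : F) g : K [:: g] -> fle w (mid_section x y g) -> fle w z.
  by move=> Kg /fle_trans; apply; apply: fle_sup_conj1.
case: T @z le1.
- move=> z le1; rewrite -[fconj _ _](fmeetT ftop).
  apply: (model_elim mx L_inhabited) => _ [q ->]; rewrite /= fmeetTl.
  rewrite -[fmeet _ _]fmeetT.
  apply: (model_elim my L_inhabited) => _ [r ->]; rewrite /= !fmeetT.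
  by apply: (le1 _ (inL ((q + r) / 2%:R))); [eexists|apply: mid_L_le].
- move=> z le1; rewrite -[fconj _ _](fmeetT ftop).
  apply: (model_elim mx U_inhabited) => _ [q ->]; rewrite /= fmeetTl.
  rewrite -[fmeet _ _]fmeetT.
  apply: (model_elim my U_inhabited) => _ [r ->]; rewrite /= !fmeetT.
  by apply: (le1 _ (inU ((q + r) / 2%:R))); [eexists|apply: mid_U_le].
- move=> q r qr z le1; rewrite [fconj _ _]fmeetT.
  apply: fsup_lub => _ [a [b [ab ->]]].
  apply: (le1 _ (inL q)) => //.
  apply: fle_trans (mid_L_le (r := a - 2%:R * (r - q)) (s := b) _ _ _); last lra.
  by apply: fmeet_mono; [apply: section_L_mono => //; lra|apply: fle_refl].
- move=> q r qr z le1; rewrite [fconj _ _]fmeetT.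
  apply: fsup_lub => _ [a [b [ab ->]]].
  apply: (le1 _ (inU r)) => //.
  apply: fle_trans (mid_U_le (r := a + 2%:R * (r - q)) (s := b) _ _ _); last lra.
  by apply: fmeet_mono; [apply: section_U_mono => //; lra|apply: fle_refl].
- move=> q z le1; rewrite [fconj _ _]fmeetT.
  apply: fsup_lub => _ [a [b [ab ->]]].
  apply: (section_L_rounded my) => b' bb'.
  apply: (le1 _ (inL ((a + b') / 2%:R))); last exact: mid_L_le.
  by eexists; last reflexivity; lra.
- move=> q z le1; rewrite [fconj _ _]fmeetT.
  apply: fsup_lub => _ [a [b [ab ->]]].
  apply: (section_U_rounded my) => b' bb'.
  apply: (le1 _ (inU ((a + b') / 2%:R))); last exact: mid_U_le.
  by eexists; last reflexivity; lra.
- move=> q z _; rewrite -[fconj _ _]/(fmeet _ (fmeet _ ftop)) fmeetT.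
  apply: fmeet_sup_le => _ [a' [b' [ab' ->]]]; rewrite fmeetC.
  apply: fmeet_sup_le => _ [a [b [ab ->]]].
  have [aa'|aa'] := leP a' a.
    apply: fle_trans (section_disjoint z mx aa'); rewrite fmeetC.
    by apply: fmeet_mono; apply: fmeet_l.
  have bb' : b' <= b by lra.
  apply: fle_trans (section_disjoint z my bb'); rewrite fmeetC.
  by apply: fmeet_mono; apply: fmeet_r.
- move=> q r qr z le1; apply: (section_interval mx (e := r - q)); first lra.
  move=> u.
  have lt_qr : 2%:R * q - u < 2%:R * r - (u + (r - q)) by lra.
  apply: (section_located my lt_qr).
    apply: (le1 _ (inL q)); first by left.
    apply: fle_trans (mid_L_le (r := u) (s := 2%:R * q - u) _ _ _); last lra.
    by apply: fmeet_mono; [apply: fmeet_l|apply: fle_refl].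
  apply: (le1 _ (inU r)); first by right.
  apply: fle_trans (mid_U_le (r := u + (r - q))
    (s := 2%:R * r - (u + (r - q))) _ _ _); last lra.
  by apply: fmeet_mono; [apply: fmeet_r|apply: fle_refl].
- move=> z _; rewrite [fconj _ _]fmeetT.
  apply: fsup_lub => _ [a [b [ab ->]]].
  have [a1|a1] := leP 1 a.
    by apply: fle_trans (fmeet_l _ _) _; apply: section_L_bound.
  by apply: fle_trans (fmeet_r _ _) _; apply: section_L_bound => //; lra.
- move=> z _; rewrite [fconj _ _]fmeetT.
  apply: fsup_lub => _ [a [b [ab ->]]].
  have [a1|a1] := leP a (-1).
    by apply: fle_trans (fmeet_l _ _) _; apply: section_U_bound.
  by apply: fle_trans (fmeet_r _ _) _; apply: section_U_bound => //; lra.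
Qed.

Definition midpoint : product II II ~> II :=
  classify (mid_sectionP
    (locmap_model (fst_ : product II II ~> II))
    (locmap_model (snd_ : product II II ~> II))) : locmap _ _.

(* Main.v *)
(** Maps into [[-1,1]] are Dedekind sections in a frame; a fixed point of the
    iteration equation is the limit of its Picard iterates, since taking the
    midpoint with a fixed section halves the distance.  For the universal
    property, [[-1,1]] and its square have enough real points (Heine-Borel and
    the tube lemma), and the points of an iterative locale [A] form an
    iterative midpoint algebra of sets.  So a homomorphism [N] to [A] is
    determined by [N x = m (a_(+-), N (2 x -+ 1))], where the sign is a binary
    digit of [x].  To solve this equation continuously, apply the iteration
    property of [A] to the line with its right-hand and its left-hand half-open
    interval topologies: the digit and the shift are continuous for each of
    them, given the right convention at [0].  The two solutions agree on
    [[-1,1]], so their common value is continuous from both sides. *)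

From mathcomp Require Import all_boot all_order all_algebra.
From mathcomp Require Import boolp classical_sets reals Rstruct lra.
Require Import Defs.

Set Implicit Arguments.
Unset Strict Implicit.
Unset Printing Implicit Defensive.

Import Order.TTheory GRing.Theory Num.Theory.
Local Open Scope ring_scope.

(** * Calculus of generalized elements in a category with finite products *)

Lemma pairing_comp (C : fpcategory) (W Z X Y : C) (f : Z ~> X) (g : Z ~> Y)
  (k : W ~> Z) : (<| f, g |> \c k = <| f \c k, g \c k |>)%cat.
Proof.
by rewrite [LHS]pairing_unique !comp_assoc fst_pairing snd_pairing.
Qed.

Lemma product_map_pairing (C : fpcategory) (Z X Y X' Y' : C) (f : X ~> X')
  (g : Y ~> Y') (h : Z ~> X) (k : Z ~> Y) :
  (product_map f g \c <| h, k |> = <| f \c h, g \c k |>)%cat.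
Proof.
by rewrite /product_map pairing_comp -!comp_assoc fst_pairing snd_pairing.
Qed.

Lemma iterationE (C : fpcategory) (A : C) (m : product A A ~> A) (X : C)
  (h M : X ~> A) (t : X ~> X) :
  (m \c product_map (idm A) M \c <| h, t |> = m \c <| h, M \c t |>)%cat.
Proof. by rewrite -comp_assoc product_map_pairing comp_idl. Qed.

(** * Points of locales *)

(** Spatiality of [X], witnessed by the family [p]: opens are compared by the chosen points that
    they contain. *)
Definition enough_points (I : Type) (X : frame) (p : I -> locmap loc1 X) :=
  forall U V : X, (forall i, p i U -> p i V) -> fle U V.

Lemma enough_points_ext (I : Type) (X A : frame) (p : I -> locmap loc1 X)
  (f g : locmap X A) : enough_points p ->
  (forall i, loccomp f (p i) = loccomp g (p i)) -> f = g.
Proof.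
move=> ep fg; apply: locmap_ext => a.
have E i : p i (f a) = p i (g a).
  by have /(congr1 (fun k : locmap loc1 A => k a)) := fg i.
by apply: fle_anti; apply: ep => i; rewrite E.
Qed.

(** The chosen points separate the opens of [X], so [phi] inherits preservation of finite meets and
    joins from the maps [f i]. A continuous function on points thus becomes a locale map. *)
Lemma locmap_of_points (I : Type) (X A : frame) (p : I -> locmap loc1 X)
  (f : I -> locmap loc1 A) (phi : A -> X) : enough_points p ->
  (forall i a, p i (phi a) <-> f i a) ->
  exists F : locmap X A, forall i, loccomp F (p i) = f i.
Proof.
move=> ep pf.
have pfE i a : p i (phi a) = f i a by apply: propext.
have ext (U V : X) : (forall i, p i U = p i V) -> U = V.
  by move=> UV; apply: fle_anti; apply: ep => i; rewrite UV.
have phi1 : phi ftop = ftop.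
  by apply: ext => i; rewrite pfE !invimage_top.
have phiM a b : phi (fmeet a b) = fmeet (phi a) (phi b).
  by apply: ext => i; rewrite pfE !invimage_meet !pfE.
have phiS S : phi (fsup S) = fsup (image_pred phi S).
  apply: ext => i; rewrite pfE !invimage_sup; apply: fsup_eq => z; split.
    by move=> [a Sa ->]; exists (phi a); [exists a|rewrite pfE].
  by move=> [_ [a Sa ->] ->]; exists a => //; rewrite pfE.
by exists (LocMap phi1 phiM phiS) => i; apply: locmap_ext => a /=.
Qed.

(** * Topological spaces as locales *)

Record space := Space {
  carrier :> Type;
  is_open : (carrier -> Prop) -> Prop;
  open_top : is_open (fun=> True);
  open_meet : forall U V,
    is_open U -> is_open V -> is_open (fun x => U x /\ V x);
  open_sup : forall S : (carrier -> Prop) -> Prop,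
    (forall U, S U -> is_open U) -> is_open (fun x => exists2 U, S U & U x)
}.

Definition space_opens (T : space) := {U : T -> Prop | is_open U}.

Lemma space_supP (T : space) (S : space_opens T -> Prop) :
  is_open (fun x : T => exists2 U, S U & sval U x).
Proof.
have : is_open (fun x : T =>
    exists2 U, (exists2 V, S V & sval V = U) & U x).
  by apply: open_sup => _ [[U oU] SU <-].
congr is_open; apply: funext => x; apply: propext; split.
  by move=> [_ [V SV <-] Vx]; exists V.
by move=> [V SV Vx]; exists (sval V) => //; exists V.
Qed.

Definition space_frame (T : space) : frame.
Proof.
refine (@Frame (space_opens T) (fun U V => forall x, sval U x -> sval V x)
  (exist _ _ (open_top T))
  (fun U V => exist _ _ (open_meet (svalP U) (svalP V)))
  (fun S => exist _ _ (space_supP S)) _ _ _ _ _ _ _).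
- by [].
- by move=> V U W UV VW x /UV /VW.
- move=> [U oU] [V oV] /= UV VU; apply: eq_exist.
  by apply: funext => x; apply: propext; split; [apply: UV|apply: VU].
- by [].
- move=> Z U V /=; split=> [H|[H1 H2] x Zx]; first by split=> x /H [].
  by split; [apply: H1|apply: H2].
- move=> S V /=; split=> [H U SU x Ux|H x [U SU]]; last exact: H.
  by apply: H; exists U.
- move=> U S; apply: eq_exist; apply: funext => x; apply: propext; split=> /=.
    move=> [Ux [V SV Vx]].
    by exists (exist _ _ (open_meet (svalP U) (svalP V))) => //; exists V.
  by move=> [_ [V SV ->] [Ux Vx]]; split=> //; exists V.
Defined.

Definition space_point (T : space) (x : T) : locmap loc1 (space_frame T).
Proof.
refine (@LocMap loc1 (space_frame T) (fun U => sval U x) _ _ _) => // S /=.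
apply: propext; split=> [[U SU Ux]|[_ [U SU ->] Ux]]; last by exists U.
by exists (sval U x) => //; exists U.
Defined.

Lemma space_enough_points (T : space) : enough_points (@space_point T).
Proof. by move=> U V UV x; apply: UV. Qed.

Lemma space_lift (T : space) (A : frame) (f : T -> locmap loc1 A) :
  (forall a, is_open (fun x => f x a : Prop)) ->
  exists F : locmap (space_frame T) A,
    forall x, loccomp F (space_point x) = f x.
Proof.
move=> cf; apply: (locmap_of_points (@space_enough_points T)
  (phi := fun a => exist _ _ (cf a) : space_frame T)).
by [].
Qed.

Definition discrete_space (T : Type) : space :=
  @Space T (fun=> True) I (fun _ _ _ _ => I) (fun _ _ => I).

(** * The iteration property for families of points *)

Section IterationOnPoints.
Variables (A : Loc) (m : product A A ~> A).
Hypothesis itA : iterative m.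

(** The data [h] and [t] lift to locale maps on the space [T]. The solution there, being a locale
    map, restricts to a continuous family of points. *)
Lemma iteration_point_exists (T : space) (h : T -> (terminal ~> A))
  (t : T -> T) :
  (forall a : A, is_open (fun x => (h x : locmap _ _) a : Prop)) ->
  (forall U, is_open U -> is_open (fun x => U (t x))) ->
  exists2 M : T -> (terminal ~> A),
    (forall x, M x = m \c <| h x, M (t x) |>)%cat &
    (forall a : A, is_open (fun x => (M x : locmap _ _) a : Prop)).
Proof.
move=> ch ct.
have [H HE] := space_lift ch.
have [G GE] : exists G : locmap (space_frame T) (space_frame T),
    forall x, loccomp G (space_point x) = space_point (t x).
  by apply: space_lift => -[U oU]; apply: ct.
have [M [ME _]] := itA (H : hom (space_frame T : Loc) A) G.
exists (fun x => M \c (space_point x : hom (_ : Loc) _))%cat.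
  move=> x; rewrite {1}ME iterationE -comp_assoc pairing_comp -comp_assoc.
  congr (_ \c <| _, _ |>)%cat; first exact: HE.
  by congr (_ \c _)%cat; apply: GE.
by move=> a; apply: (svalP ((M : locmap _ _) a)).
Qed.

(** Over the discrete space on [D] every function lifts to a locale map. The uniqueness half of
    [iterative] therefore compares arbitrary, possibly discontinuous, families of points. *)
Lemma iteration_point_unique (T : Type) (D : T -> Prop)
  (h : T -> (terminal ~> A)) (t : T -> T) (M M' : T -> (terminal ~> A)) :
  (forall x, D x -> D (t x)) ->
  (forall x, D x -> M x = (m \c <| h x, M (t x) |>)%cat) ->
  (forall x, D x -> M' x = (m \c <| h x, M' (t x) |>)%cat) ->
  forall x, D x -> M x = M' x.
Proof.
move=> Dt ME M'E x Dx.
pose X := discrete_space {x | D x}.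
have lift (f : X -> (terminal ~> A)) : exists F : (space_frame X : Loc) ~> A,
    forall x, (F \c (space_point x : hom (_ : Loc) _))%cat = f x.
  exact: (@space_lift X A f (fun _ => I)).
pose t' (y : X) : X := exist D _ (Dt _ (svalP y)).
have [G GE] : exists G : locmap (space_frame X) (space_frame X),
    forall x, loccomp G (space_point x) = space_point (t' x).
  exact: (@space_lift X _ (fun x => space_point (t' x)) (fun _ => I)).
have [H HE] := lift (fun y => h (sval y)).
have sol (f : T -> (terminal ~> A)) F :
    (forall x, D x -> f x = (m \c <| h x, f (t x) |>)%cat) ->
    (forall x : X, (F \c (space_point x : hom (_ : Loc) _))%cat = f (sval x)) ->
    F = (m \c product_map (idm A) F \c <| H, (G : hom (_ : Loc) _) |>)%cat.
  move=> fE FE; apply: (enough_points_ext (@space_enough_points X)) => y.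
  rewrite iterationE -[LHS]/((F : hom (_ : Loc) _) \c
    (space_point y : hom (_ : Loc) _))%cat.
  rewrite -[RHS]/(_ \c (space_point y : hom (_ : Loc) _))%cat.
  rewrite FE fE; last exact: svalP.
  rewrite -comp_assoc pairing_comp -comp_assoc.
  have E2 : (F \c ((G : hom (_ : Loc) _) \c
      (space_point y : hom (_ : Loc) _)))%cat = f (t (sval y)).
    rewrite -[RHS](FE (t' y)).
    exact: (congr1 (fun k => F \c (k : hom (_ : Loc) _))%cat (GE y)).
  exact: (congr2 (fun u v : terminal ~> A => m \c <| u, v |>)%cat
    (esym (HE y)) (esym E2)).
have [F FE] := lift (fun y => M (sval y)).
have [F' F'E] := lift (fun y => M' (sval y)).
have [K [_ KU]] := itA H (G : hom (_ : Loc) _).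
have FF' : F = F'.
  by rewrite -(KU F); [rewrite -(KU F') //; apply: sol F'E|apply: sol FE].
by have := FE (exist _ x Dx); rewrite FF' F'E.
Qed.

End IterationOnPoints.

(** * The midpoint algebra of Dedekind sections *)

Definition section_of (X : frame) (f : locmap X II) (g : section_gen) : X :=
  f (generator section_theory g).

Lemma section_ofP (X : frame) (f : locmap X II) :
  model section_theory (section_of f).
Proof. exact: locmap_model. Qed.

Lemma section_of_classify (X : frame) (x : section_gen -> X)
  (mx : model section_theory x) : section_of (classify mx) = x.
Proof. by apply: funext => g; rewrite /section_of classifyE. Qed.

Lemma section_of_inj (X : frame) (f g : locmap X II) :
  section_of f = section_of g -> f = g.
Proof.
by move=> fg; apply: locmap_classifying_ext => a; apply: (congr1 (@^~ a) fg).
Qed.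

(** Reduces the algebra of generalized elements of [II] to calculations with sections in a single
    frame. *)
Lemma section_of_midpoint (X : frame) (f g : locmap X II) :
  section_of (loccomp midpoint (locpair f g)) =
  mid_section (section_of f) (section_of g).
Proof.
apply: funext => a.
transitivity (locpair f g
  ((midpoint : locmap _ _) (generator section_theory a))); first by [].
rewrite /midpoint classifyE.
have E (q r : II) :
    locpair f g (fmeet (locfst II II q) (locsnd II II r)) = fmeet (f q) (g r).
  by rewrite -rectE locpair_rect.
by case: a => q; rewrite /mid_section invimage_sup; apply: fsup_eq => z; (split;
  [ by move=> [_ [r [s [rs ->]]] ->]; exists r, s; rewrite E
  | by move=> [r [s [rs ->]]];
       eexists; [by exists r, s; split; last reflexivity|rewrite E]]).
Qed.

(** Sections are maximal: if [q < r] and [r] is in the lower cut of [y], locatedness of [x] puts [q]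
    in its lower cut or [r] in its upper cut. The latter lies inside the upper cut of [y] and
    contradicts disjointness. Upper cuts are dual. *)
Lemma section_le_eq (F : frame) (x y : section_gen -> F) :
  model section_theory x -> model section_theory y ->
  (forall g, fle (x g) (y g)) -> x = y.
Proof.
move=> mx my xy; apply: funext => g; apply: fle_anti => //.
case: g => q; rewrite -[y _]fmeetTl.
  apply: (section_L_rounded my) => r qr; rewrite fmeetTl.
  apply: (section_located mx qr); first exact: fmeet_r.
  apply: fle_trans (section_disjoint _ my (lexx r)).
  by apply: fmeet_mono; [exact: fle_refl|exact: xy].
apply: (section_U_rounded my) => r rq; rewrite fmeetTl.
apply: (section_located mx rq); last exact: fmeet_r.
apply: fle_trans (section_disjoint _ my (lexx r)); rewrite fmeetC.
by apply: fmeet_mono; [exact: xy|exact: fle_refl].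
Qed.

Lemma mid_section_le (F : frame) (x y z : section_gen -> F) :
  (forall r s,
    fle (fmeet (x (inL r)) (y (inL s))) (z (inL ((r + s) / 2%:R)))) ->
  (forall r s,
    fle (fmeet (x (inU r)) (y (inU s))) (z (inU ((r + s) / 2%:R)))) ->
  forall g, fle (mid_section x y g) (z g).
Proof.
by move=> HL HU [] q; apply: fsup_lub => _ [r [s [<- ->]]].
Qed.

Lemma mid_section_id (F : frame) (x : section_gen -> F) :
  model section_theory x -> mid_section x x = x.
Proof.
move=> mx; apply: section_le_eq => //; first exact: mid_sectionP.
apply: mid_section_le => r s; have [rs|sr] := leP r s.
- by apply: fle_trans (fmeet_r _ _) (section_L_mono mx _); lra.
- by apply: fle_trans (fmeet_l _ _) (section_L_mono mx _); lra.
- by apply: fle_trans (fmeet_l _ _) (section_U_mono mx _); lra.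
- by apply: fle_trans (fmeet_r _ _) (section_U_mono mx _); lra.
Qed.

Lemma mid_sectionC (F : frame) (x y : section_gen -> F) :
  model section_theory x -> model section_theory y ->
  mid_section x y = mid_section y x.
Proof.
move=> mx my; apply: section_le_eq; [exact: mid_sectionP..|].
by apply: mid_section_le => r s; rewrite fmeetC;
  [apply: mid_L_le|apply: mid_U_le]; rewrite addrC.
Qed.

Lemma fmeetACA (F : frame) (x y z w : F) :
  fmeet (fmeet x y) (fmeet z w) = fmeet (fmeet x z) (fmeet y w).
Proof. by rewrite -!fmeetA; congr fmeet; rewrite !fmeetA (fmeetC y). Qed.

Lemma mid_sectionACA (F : frame) (x y z w : section_gen -> F) :
  model section_theory x -> model section_theory y ->
  model section_theory z -> model section_theory w ->
  mid_section (mid_section x y) (mid_section z w) =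
  mid_section (mid_section x z) (mid_section y w).
Proof.
move=> mx my mz mw.
apply: section_le_eq; [by do ?apply: mid_sectionP..|].
apply: mid_section_le => r s /=; apply: fmeet_sup_le => _ [c [d [cd ->]]];
  rewrite fmeetC; apply: fmeet_sup_le => _ [a [b [ab ->]]];
  rewrite fmeetC fmeetACA.
- apply: fle_trans (fmeet_mono (mid_L_le _ _ erefl) (mid_L_le _ _ erefl)) _.
  by apply: mid_L_le; lra.
- apply: fle_trans (fmeet_mono (mid_U_le _ _ erefl) (mid_U_le _ _ erefl)) _.
  by apply: mid_U_le; lra.
Qed.

Lemma II_midpoint_algebra : midpoint_algebra midpoint.
Proof.
have mP := section_ofP.
split=> [X x|X x y|X x y z w]; apply: section_of_inj.
- by rewrite [LHS]section_of_midpoint mid_section_id.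
- by rewrite [LHS]section_of_midpoint [RHS]section_of_midpoint mid_sectionC.
- rewrite [LHS]section_of_midpoint [RHS]section_of_midpoint.
  rewrite (section_of_midpoint x y) (section_of_midpoint z w).
  rewrite (section_of_midpoint x z) (section_of_midpoint y w).
  exact: mid_sectionACA.
Qed.

(** * Iteration in the interval as a Banach fixed point *)

(** Encodes [|x - y| <= e] by translating each cut by [e]. *)
Record section_near (F : frame) (e : rat) (x y : section_gen -> F) : Prop :=
  SectionNear {
    nearL : forall q, fle (x (inL q)) (y (inL (q - e)));
    nearLr : forall q, fle (y (inL q)) (x (inL (q - e)));
    nearU : forall q, fle (x (inU q)) (y (inU (q + e)));
    nearUr : forall q, fle (y (inU q)) (x (inU (q + e)))
  }.

Lemma section_near_sym (F : frame) (e : rat) (x y : section_gen -> F) :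
  section_near e x y -> section_near e y x.
Proof. by case. Qed.

Lemma section_near_trans (F : frame) (e d : rat) (x y z : section_gen -> F) :
  section_near e x y -> section_near d y z -> section_near (e + d) x z.
Proof.
move=> [a1 a2 a3 a4] [b1 b2 b3 b4]; split=> q.
- by apply: fle_trans (a1 q) _; rewrite opprD addrA.
- by apply: fle_trans (b2 q) _; rewrite opprD addrCA addrC.
- by apply: fle_trans (a3 q) _; rewrite addrA.
- by apply: fle_trans (b4 q) _; rewrite addrCA addrC.
Qed.

Lemma section_near_mono (F : frame) (e d : rat) (x y : section_gen -> F) :
  model section_theory x -> model section_theory y -> e <= d ->
  section_near e x y -> section_near d x y.
Proof.
move=> mx my ed [a1 a2 a3 a4]; split=> q.
- by apply: fle_trans (a1 q) (section_L_mono my _); lra.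
- by apply: fle_trans (a2 q) (section_L_mono mx _); lra.
- by apply: fle_trans (a3 q) (section_U_mono my _); lra.
- by apply: fle_trans (a4 q) (section_U_mono mx _); lra.
Qed.

(** Roundedness moves a bound [q] strictly to some [r], and nearness with [e] the gap between them
    brings it back to [q]. *)
Lemma section_near_eq (F : frame) (x y : section_gen -> F) :
  model section_theory x -> model section_theory y ->
  (forall e, 0 < e -> section_near e x y) -> x = y.
Proof.
move=> mx my xy; apply: section_le_eq => // -[] q; rewrite -[x _]fmeetTl.
  apply: (section_L_rounded mx) => r qr; rewrite fmeetTl.
  have /xy[/(_ r)] : 0 < r - q by lra.
  by have -> : r - (r - q) = q by lra.
apply: (section_U_rounded mx) => r qr; rewrite fmeetTl.
have /xy[_ _ /(_ r)] : 0 < q - r by lra.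
by have -> : r + (q - r) = q by lra.
Qed.

Lemma section_L_bottom (F : frame) (x : section_gen -> F) (q : rat) (w : F) :
  model section_theory x -> q < -1 -> fle w (x (inL q)).
Proof.
move=> mx q1; apply: (section_located mx q1); first exact: fmeet_r.
by apply: fle_trans (fmeet_r _ _) _; apply: section_U_bound.
Qed.

Lemma section_U_bottom (F : frame) (x : section_gen -> F) (q : rat) (w : F) :
  model section_theory x -> 1 < q -> fle w (x (inU q)).
Proof.
move=> mx q1; apply: (section_located mx q1); last exact: fmeet_r.
by apply: fle_trans (fmeet_r _ _) _; apply: section_L_bound.
Qed.

(** The interval has diameter [2]: the lower cut of a section is empty from [1] on and contains
    everything below [-1], and dually. *)
Lemma section_near2 (F : frame) (x y : section_gen -> F) :
  model section_theory x -> model section_theory y -> section_near 2%:R x y.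
Proof.
have L (u v : section_gen -> F) q : model section_theory u ->
    model section_theory v -> fle (u (inL q)) (v (inL (q - 2%:R))).
  move=> mu mv; have [q1|q1] := leP 1 q; first exact: section_L_bound.
  by apply: section_L_bottom => //; lra.
have U (u v : section_gen -> F) q : model section_theory u ->
    model section_theory v -> fle (u (inU q)) (v (inU (q + 2%:R))).
  move=> mu mv; have [q1|q1] := leP q (-1); first exact: section_U_bound.
  by apply: section_U_bottom => //; lra.
by move=> mx my; split=> q; [exact: L..|exact: U|exact: U].
Qed.

(** The contraction estimate: moving [s] by [e] moves [(r + s) / 2] by [e / 2]. *)
Lemma mid_section_near (F : frame) (e : rat) (h x y : section_gen -> F) :
  section_near e x y ->
  section_near (e / 2%:R) (mid_section h x) (mid_section h y).
Proof.
move=> [a1 a2 a3 a4]; split=> q; apply: fsup_lub => _ [r [s [rs ->]]].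
- apply: fle_trans (fmeet_mono (fle_refl _) (a1 s)) _.
  by apply: mid_L_le; lra.
- apply: fle_trans (fmeet_mono (fle_refl _) (a2 s)) _.
  by apply: mid_L_le; lra.
- apply: fle_trans (fmeet_mono (fle_refl _) (a3 s)) _.
  by apply: mid_U_le; lra.
- apply: fle_trans (fmeet_mono (fle_refl _) (a4 s)) _.
  by apply: mid_U_le; lra.
Qed.

Lemma locmap_near (X Y : frame) (t : locmap X Y) (e : rat)
  (x y : section_gen -> Y) :
  section_near e x y -> section_near e (fun g => t (x g)) (fun g => t (y g)).
Proof. by move=> [a1 a2 a3 a4]; split=> q; apply: locmap_mono. Qed.

(** The number [e n] bounds the error of the approximation [x n], so a rational is below the limit
    as soon as it is below [x n] by a margin of [e n]. *)
Definition limit_section (F : frame) (x : nat -> section_gen -> F)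
    (e : nat -> rat) (g : section_gen) : F :=
  match g with
  | inL q => fsup (fun z => exists n, z = x n (inL (q + e n)))
  | inU q => fsup (fun z => exists n, z = x n (inU (q - e n)))
  end.

Section Limit.
Variables (F : frame) (x : nat -> section_gen -> F) (e : nat -> rat).
Hypothesis mx : forall n, model section_theory (x n).
Hypothesis e0 : forall d, 0 < d -> exists n, e n < d.
Hypothesis epos : forall n, 0 < e n.
Hypothesis cauchy : forall n k, section_near (e n) (x n) (x (n + k)).

Let limL n q : fle (x n (inL (q + e n))) (limit_section x e (inL q)).
Proof. by apply: fle_sup; exists n. Qed.

Let limU n q : fle (x n (inU (q - e n))) (limit_section x e (inU q)).
Proof. by apply: fle_sup; exists n. Qed.

Lemma limit_sectionP : model section_theory (limit_section x e).
Proof.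
move=> l K T; set z := fsup _.
have le1 (w : F) g : K [:: g] -> fle w (limit_section x e g) -> fle w z.
  by move=> Kg /fle_trans; apply; apply: fle_sup_conj1.
case: T @z le1.
- move=> z le1; rewrite -[fconj _ _](fmeetT ftop).
  apply: (model_elim (mx 0) L_inhabited) => _ [q ->]; rewrite /= fmeetTl fmeetT.
  apply: (le1 _ (inL (q - e 0))); first by eexists.
  by apply: fle_trans (limL 0 _); rewrite subrK; apply: fle_refl.
- move=> z le1; rewrite -[fconj _ _](fmeetT ftop).
  apply: (model_elim (mx 0) U_inhabited) => _ [q ->]; rewrite /= fmeetTl fmeetT.
  apply: (le1 _ (inU (q + e 0))); first by eexists.
  by apply: fle_trans (limU 0 _); rewrite addrK; apply: fle_refl.
- move=> q r qr z le1; rewrite [fconj _ _]fmeetT.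
  apply: fsup_lub => _ [n ->]; apply: (le1 _ (inL q)) => //.
  by apply: fle_trans (limL n _); apply: section_L_mono => //; lra.
- move=> q r qr z le1; rewrite [fconj _ _]fmeetT.
  apply: fsup_lub => _ [n ->]; apply: (le1 _ (inU r)) => //.
  by apply: fle_trans (limU n _); apply: section_U_mono => //; lra.
- move=> q z le1; rewrite [fconj _ _]fmeetT.
  apply: fsup_lub => _ [n ->]; rewrite -[x n _]fmeetTl.
  apply: section_L_rounded => // r qr; rewrite fmeetTl.
  apply: (le1 _ (inL (r - e n))); first by eexists; last reflexivity; lra.
  by apply: fle_trans (limL n _); rewrite subrK; apply: fle_refl.
- move=> q z le1; rewrite [fconj _ _]fmeetT.
  apply: fsup_lub => _ [n ->]; rewrite -[x n _]fmeetTl.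
  apply: section_U_rounded => // r qr; rewrite fmeetTl.
  apply: (le1 _ (inU (r + e n))); first by eexists; last reflexivity; lra.
  by apply: fle_trans (limU n _); rewrite addrK; apply: fle_refl.
- move=> q z _; rewrite -[fconj _ _]/(fmeet _ (fmeet _ ftop)) fmeetT.
  apply: fmeet_sup_le => _ [n ->]; rewrite fmeetC.
  apply: fmeet_sup_le => _ [k ->]; rewrite fmeetC.
  (* Both cuts are compared at the later of the two terms, where the error of the earlier one has
     been used up. *)
  have [/subnKC <-|/ltnW/subnKC <-] := leqP k n.
    have := nearL (cauchy k (n - k)) (q + e k); rewrite addrK => H.
    apply: fle_trans (fmeet_mono H (fle_refl _)) _.
    by apply: section_disjoint => //; have := epos (k + (n - k)); lra.
  have := nearU (cauchy n (k - n)) (q - e n); rewrite subrK => H.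
  apply: fle_trans (fmeet_mono (fle_refl _) H) _.
  by apply: section_disjoint => //; have := epos (n + (k - n)); lra.
(* The gap between [q] and [r] must leave a margin of [e n] at both ends. *)
- move=> q r qr z le1; have [n en] : exists n, e n < (r - q) / 2%:R.
    by apply: e0; lra.
  have lt_qr : q + e n < r - e n by lra.
  apply: (section_located (mx n) lt_qr).
    by apply: (le1 _ (inL q)); [left|apply: fle_trans (fmeet_r _ _) (limL n _)].
  by apply: (le1 _ (inU r)); [right|apply: fle_trans (fmeet_r _ _) (limU n _)].
- move=> z _; rewrite [fconj _ _]fmeetT; apply: fsup_lub => _ [n ->].
  by apply: section_L_bound => //; have := epos n; lra.
- move=> z _; rewrite [fconj _ _]fmeetT; apply: fsup_lub => _ [n ->].
  by apply: section_U_bound => //; have := epos n; lra.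
Qed.

Lemma limit_section_near n : section_near (e n) (x n) (limit_section x e).
Proof.
split=> q.
- by apply: fle_trans (limL n _); rewrite subrK; apply: fle_refl.
- apply: fsup_lub => _ [k ->].
  have [/subnKC <-|/ltnW/subnKC <-] := leqP k n.
    apply: fle_trans (nearL (cauchy k (n - k)) _) _.
    by apply: section_L_mono => //; have := epos (k + (n - k)); lra.
  apply: fle_trans (nearLr (cauchy n (k - n)) _) _.
  by apply: section_L_mono => //; have := epos (n + (k - n)); lra.
- by apply: fle_trans (limU n _); rewrite addrK; apply: fle_refl.
- apply: fsup_lub => _ [k ->].
  have [/subnKC <-|/ltnW/subnKC <-] := leqP k n.
    apply: fle_trans (nearU (cauchy k (n - k)) _) _.
    by apply: section_U_mono => //; have := epos (k + (n - k)); lra.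
  apply: fle_trans (nearUr (cauchy n (k - n)) _) _.
  by apply: section_U_mono => //; have := epos (n + (k - n)); lra.
Qed.

End Limit.

(** The diameter [2] of the interval after [n] halvings, which bounds the error of the [n]-th Picard
    iterate. *)
Definition radius (n : nat) : rat := 2%:R / 2%:R ^+ n.

Lemma radiusS n : radius n.+1 = radius n / 2%:R.
Proof. by rewrite /radius exprS invfM mulrA mulrAC. Qed.

Lemma radius_gt0 n : 0 < radius n.
Proof. by rewrite divr_gt0 ?exprn_gt0. Qed.

Lemma radius_small (d : rat) : 0 < d -> exists n, radius n < d.
Proof.
move=> d0; exists (Num.bound (2%:R / d)).
have d2 : 0 <= 2%:R / d by apply: divr_ge0; lra.
rewrite /radius ltr_pdivrMr ?exprn_gt0 // mulrC -ltr_pdivrMr //.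
apply: lt_trans (archi_boundP d2) _.
by rewrite -natrX ltr_nat ltn_expl.
Qed.

Lemma II_iterative : iterative midpoint.
Proof.
move=> X h t.
pose step (x : section_gen -> (X : frame)) :=
  mid_section (section_of h) (fun g => (t : locmap X X) (x g)).
have stepE (M : X ~> II) :
    section_of (midpoint \c product_map (idm _) M \c <| h, t |>)%cat =
    step (section_of M).
  by rewrite iterationE [LHS]section_of_midpoint.
have stepP x : model section_theory x -> model section_theory (step x).
  move=> mx; apply: mid_sectionP; first exact: section_ofP.
  have := section_ofP (loccomp (classify mx) t).
  congr model; apply: funext => g.
  by rewrite -[LHS]/((t : locmap X X) (section_of (classify mx) g))
    section_of_classify.
have step_near e x y : section_near e x y ->
    section_near (e / 2%:R) (step x) (step y).
  by move=> xy; apply: mid_section_near; apply: locmap_near.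
pose x n := iter n step (section_of h).
have mx n : model section_theory (x n).
  by elim: n => [|n IH]; [exact: section_ofP|exact: stepP].
(* [x 0] and [x k] differ by at most the diameter, and each further application of [step] to both
   halves the bound. *)
have cauchy n k : section_near (radius n) (x n) (x (n + k)%N).
  elim: n => [|n IH]; last by rewrite radiusS; apply: step_near.
  by rewrite /radius divr1; apply: section_near2.
pose y := limit_section x radius.
have my : model section_theory y.
  exact: limit_sectionP mx radius_small radius_gt0 cauchy.
(* Both [y] and [step y] are close to [x n.+1], which is [step (x n)]; the two errors add up to
   [radius n]. *)
have yE : y = step y.
  apply: section_near_eq => // [|e e0]; first exact: stepP.
  have [n ne] : exists n, radius n < e / 2%:R by apply: radius_small; lra.
  have xy k : section_near (radius k) (x k) y.
    exact: limit_section_near mx radius_gt0 cauchy k.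
  apply: section_near_mono (section_near_trans
    (section_near_sym (xy n.+1)) (step_near _ _ _ (xy n))) => //.
    exact: stepP.
  by rewrite radiusS; have := radius_gt0 n; lra.
exists (classify my); split.
  by apply: section_of_inj; rewrite stepE section_of_classify.
(* Two fixed points of [step] are within [2] of each other, and applying [step] to both halves that
   bound indefinitely. *)
move=> M ME; apply: section_of_inj; rewrite section_of_classify.
have {}ME : section_of M = step (section_of M) by rewrite -stepE -ME.
have mM := section_ofP M.
apply: section_near_eq => // e e0; have [n /ltW ne] := radius_small e0.
apply: section_near_mono ne _ => //.
elim: n => [|n IH]; first by rewrite /radius divr1; apply: section_near2.
by rewrite radiusS yE ME; apply: step_near.
Qed.

(** * The interval has enough points *)

Section RealPoints.
Variable R : realType.

Lemma ratr_between (x y : R) :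
  x < y -> exists2 q : rat, x < ratr q & ratr q < y.
Proof.
by move=> /rat_in_itvoo [q]; rewrite in_itv /= => /andP[]; exists q.
Qed.

Definition real_section (x : R) (g : section_gen) : loc1 :=
  match g with inL q => ratr q < x | inU q => x < ratr q end.

Lemma loc1_cover1 (G : Type) (h : G -> loc1) (K : seq G -> Prop) (g : G) :
  K [:: g] -> (h g : Prop) -> (fsup (image_pred (fconj h) K) : Prop).
Proof. by move=> Kg hg; apply: (fle_sup_conj1 h Kg). Qed.

Lemma real_sectionP (x : R) :
  -1 <= x <= 1 -> model section_theory (real_section x).
Proof.
move=> /andP[x1 x2] l K [].
- move=> _; have [|q _ qx] := @ratr_between (x - 1) x; first lra.
  by apply: (loc1_cover1 (g := inL q)); first by eexists.
- move=> _; have [|q xq _] := @ratr_between x (x + 1); first lra.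
  by apply: (loc1_cover1 (g := inU q)); first by eexists.
- move=> q r qr [rx _]; apply: (loc1_cover1 (g := inL q)) => //=.
  by apply: lt_trans rx; rewrite ltr_rat.
- move=> q r qr [rx _]; apply: (loc1_cover1 (g := inU r)) => //=.
  by apply: lt_trans rx _; rewrite ltr_rat.
- move=> q [qx _]; have [r qr rx] := ratr_between qx.
  by apply: (loc1_cover1 (g := inL r)) => //; exists r; rewrite // -(ltr_rat R).
- move=> q [qx _]; have [r qr rx] := ratr_between qx.
  by apply: (loc1_cover1 (g := inU r)) => //; exists r; rewrite // -(ltr_rat R).
- by move=> q [/= qx [/(lt_trans qx)]]; rewrite ltxx.
- move=> q r; rewrite -(ltr_rat R) => qr _; have [xq|qx] := leP x (ratr q).
    apply: (loc1_cover1 (g := inU r)); first by right.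
    exact: le_lt_trans xq qr.
  by apply: (loc1_cover1 (g := inL q)); first by left.
- by move=> [/=]; rewrite rmorph1 ltNge x2.
- by move=> [/=]; rewrite rmorphN1 ltNge x1.
Qed.

Definition segment := {x : R | -1 <= x <= 1}.

Definition in_segment (x : R) (hx : -1 <= x <= 1) : segment := exist _ x hx.

Definition real_point (x : segment) : locmap loc1 II :=
  classify (real_sectionP (svalP x)).

Lemma real_pointL (x : segment) q :
  real_point x (generator section_theory (inL q)) = (ratr q < sval x) :> Prop.
Proof. exact: (classifyE (real_sectionP (svalP x))). Qed.

Lemma real_pointU (x : segment) q :
  real_point x (generator section_theory (inU q)) = (sval x < ratr q) :> Prop.
Proof. exact: (classifyE (real_sectionP (svalP x))). Qed.

Notation gL q := (generator section_theory (inL q) : II).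
Notation gU q := (generator section_theory (inU q) : II).

Lemma generatorP : model section_theory (generator section_theory).
Proof. exact: section_ofP (locid II). Qed.

Lemma fconj_cons (G : Type) (F : frame) (h : G -> F) (g : G) (l : seq G) :
  fconj h (g :: l) = fmeet (h g) (fconj h l).
Proof. by []. Qed.

(** A basic open is a finite conjunction of rays; the largest lower bound and the smallest upper
    bound cut out an interval inside it. *)
Lemma real_point_nbhd (x : segment) (U : II) : real_point x U ->
  exists p q,
    [/\ ratr p < sval x, sval x < ratr q & fle (fmeet (gL p) (gU q)) U].
Proof.
rewrite {1}(sup_principal U) invimage_sup => -[_ [_ [l Ul ->] ->]].
have lU := (principal_le l U).2 Ul.
rewrite principal_conj in lU *; move: lU => /[swap] xl /(fle_trans _) lU.
suff [p [q [px xq /lU]]] : exists p q, [/\ ratr p < sval x, sval x < ratr q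
    & fle (fmeet (gL p) (gU q)) (fconj (generator section_theory) l)].
  by exists p, q.
elim: l xl {Ul lU} => [_|g l IH].
  have [|p _ px] := @ratr_between (sval x - 1) (sval x); first lra.
  have [|q xq _] := @ratr_between (sval x) (sval x + 1); first lra.
  by exists p, q; split=> //; apply: fle_top.
rewrite fconj_cons invimage_meet => -[xg /IH[p [q [px xq pql]]]].
case: g xg => r; rewrite ?real_pointL ?real_pointU => xr.
  exists (Num.max p r), q; split=> //; first by case: (leP p r).
  have le_max s : s <= Num.max p r -> fle (gL (Num.max p r)) (gL s).
    exact: section_L_mono generatorP.
  apply: fle_meetI.
    apply: fle_trans (fmeet_l _ _) _.
    by apply: le_max; rewrite le_max lexx orbT.
  apply: fle_trans pql; apply: fmeet_mono (fle_refl _).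
  by apply: le_max; rewrite le_max lexx.
exists p, (Num.min q r); split=> //; first by case: (leP q r).
have ge_min s : Num.min q r <= s -> fle (gU (Num.min q r)) (gU s).
  exact: section_U_mono generatorP.
apply: fle_meetI.
  by apply: fle_trans (fmeet_r _ _) _; apply: ge_min; rewrite ge_min lexx orbT.
apply: fle_trans pql; apply: fmeet_mono; first exact: fle_refl.
by apply: ge_min; rewrite ge_min lexx.
Qed.

(** * Compactness and regularity of the interval, and spatiality *)

Definition fjoin (F : frame) (a b : F) : F := fsup (fun z => z = a \/ z = b).

Lemma fjoin_l (F : frame) (a b : F) : fle a (fjoin a b).
Proof. by apply: fle_sup; left. Qed.

Lemma fjoin_r (F : frame) (a b : F) : fle b (fjoin a b).
Proof. by apply: fle_sup; right. Qed.

Lemma fmeet_join_le (F : frame) (w a b z : F) :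
  fle (fmeet w a) z -> fle (fmeet w b) z -> fle (fmeet w (fjoin a b)) z.
Proof. by move=> az bz; apply: fmeet_sup_le => _ [] ->. Qed.

(* Heine-Borel: consider the supremum of the x for which P contains some
   left-unbounded interval beyond x. *)
Lemma compact_ind (P : II -> Prop) :
  (forall U V, fle U V -> P V -> P U) ->
  (forall U V, P U -> P V -> P (fjoin U V)) ->
  (forall x, exists2 U, real_point x U : Prop & P U) -> P ftop.
Proof.
move=> Pdown Pjoin Ppt.
pose E : set R := fun x =>
  -1 <= x <= 1 /\ exists2 q : rat, x < ratr q & P (gU q).
(* As [p < r], the interval from [p] to [q] and the ray below [r] together cover the ray below
   [q]. *)
have extend (p q r : rat) : p < r -> P (fmeet (gL p) (gU q)) -> P (gU r) ->
    P (gU q).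
  move=> pr Ppq Pr; apply: Pdown (Pjoin _ _ Ppq Pr).
  apply: (section_located generatorP pr).
    by apply: fle_trans (fjoin_l _ _); rewrite fmeetC; apply: fle_refl.
  exact: fle_trans (fmeet_r _ _) (fjoin_r _ _).
have nbhd (x : R) : -1 <= x <= 1 -> exists p q : rat,
    [/\ ratr p < x, x < ratr q & P (fmeet (gL p) (gU q))].
  move=> hx; have [U xU PU] := Ppt (in_segment hx).
  have [p [q [px xq pqU]]] := real_point_nbhd xU.
  by exists p, q; split=> //; apply: Pdown PU.
have E1 : E (-1).
  have h1 : -1 <= (-1 : R) <= 1 by lra.
  split=> //; have [p [q [px xq Ppq]]] := nbhd _ h1; exists q => //.
  have p1 : p < -1 by rewrite -(ltr_rat R) rmorphN1.
  apply: (extend _ _ _ p1 Ppq); apply: Pdown Ppq.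
  exact: section_U_bound generatorP _.
have supE : has_sup E.
  by split; [exists (-1)|exists 1 => x [/andP[]]].
have hs : -1 <= sup E <= 1.
  rewrite ub_le_sup //=; last by case: supE.
  by apply: ge_sup => [|x [/andP[]] //]; exists (-1).
have [p [q [ps sq Ppq]]] := nbhd _ hs.
have Pq : P (gU q).
  have e0 : 0 < sup E - ratr p by rewrite subr_gt0.
  have [x [_ [r xr Pr]] px] := sup_adherent e0 supE.
  apply: extend Ppq Pr; rewrite -(ltr_rat R); apply: lt_trans xr.
  by move: px; rewrite subKr.
(* If [1 < q], the ray below [q] is everything; otherwise a rational between [sup E] and [q] would
   lie in [E]. *)
have [q1|q1] := ltP 1 q.
  by apply: Pdown Pq; apply: section_U_bottom generatorP _.
have {}q1 : ratr q <= 1 :> R by rewrite -(rmorph1 (@ratr R)) ler_rat.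
have [y sy yq] := ratr_between sq.
have : ratr y <= sup E.
  apply: ub_le_sup; first by case: supE.
  by split; [lra|exists q].
by rewrite leNgt sy.
Qed.

Lemma real_point_join (x : segment) (U V : II) :
  real_point x (fjoin U V) <-> (real_point x U \/ real_point x V).
Proof.
split; last by case=> /(@locmap_mono _ _ (real_point x) _ _ _)-/(_ (fjoin U V));
  apply; [apply: fjoin_l|apply: fjoin_r].
by rewrite invimage_sup => -[_ [_ [] -> ->]]; [left|right].
Qed.

(** The rather-below relation of regular locales, with the covering by [U] and [K] stated at real
    points, the form in which it feeds [compact_ind]. *)
Definition well_inside (V U : II) := exists2 K : II,
  (forall w, fle (fmeet V K) w) & forall x, real_point x U \/ real_point x K.

(** By roundedness a ray is the join of strictly smaller rays, each well inside it with the opposite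
    ray as [K]. Finite meets are handled by joining the witnesses [K]. *)
Lemma II_regular (U z : II) :
  (forall V, well_inside V U -> fle V z) -> fle U z.
Proof.
move=> H; rewrite (sup_principal U); apply: fsup_lub => _ [l Ul ->].
have lz V : well_inside V (principal (l : theory_site section_theory)) ->
    fle V z.
  move=> [K VK lK]; apply: H; exists K => // x.
  have [xl|xK] := lK x; last by right.
  by left; apply: (locmap_mono (real_point x) _ xl); apply/principal_le.
apply: fle_trans (fsup_lub lz); rewrite principal_conj.
elim: l {Ul lz} => [|g l IH].
  apply: fle_sup; exists (fsup (fun=> False)) => [w|x].
    exact: fmeet_sup_le.
  by left; rewrite invimage_top.
rewrite fconj_cons; apply: fle_trans (fmeet_mono (fle_refl _) IH) _.
apply: fmeet_sup_le => V [K VK lK]; rewrite fmeetC.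
have conj_inside (W J : II) : (forall w, fle (fmeet W J) w) ->
    (forall x, real_point x (generator section_theory g) \/ real_point x J) ->
    well_inside (fmeet V W) (fmeet (generator section_theory g)
      (fconj (generator section_theory) l)).
  move=> WJ gJ; exists (fjoin K J) => [w|x].
    apply: fmeet_join_le.
      exact: fle_trans (fmeet_mono (fmeet_l _ _) (fle_refl _)) (VK w).
    exact: fle_trans (fmeet_mono (fmeet_r _ _) (fle_refl _)) (WJ w).
  rewrite real_point_join invimage_meet.
  have [xg|xJ] := gJ x; last by right; right.
  by have [xl|xK] := lK x; [left|right; left].
case: g conj_inside => q conj_inside.
  apply: (section_L_rounded generatorP) => r qr; apply: fle_sup.
  apply: (conj_inside _ (gU r)) => [w|x].
    exact: section_disjoint generatorP (lexx r).
  rewrite real_pointL real_pointU; have [xr|rx] := ltP (sval x) (ratr r).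
    by right.
  by left; apply: lt_le_trans rx; rewrite ltr_rat.
apply: (section_U_rounded generatorP) => r rq; apply: fle_sup.
apply: (conj_inside _ (gL r)) => [w|x].
  by rewrite fmeetC; apply: section_disjoint generatorP (lexx r).
rewrite real_pointL real_pointU; have [xr|rx] := ltP (ratr r) (sval x).
  by right.
by left; apply: le_lt_trans rx _; rewrite ltr_rat.
Qed.

(** For [W] well inside [U], every real point has a neighbourhood [J] with [fmeet W J] below [V]:
    take [V] at points of [U] and [K] elsewhere. Compactness extends this to [J = ftop]. *)
Lemma real_enough_points : enough_points real_point.
Proof.
move=> U V UV; apply: II_regular => W [K WK UK].
rewrite -[W]fmeetT.
apply: (compact_ind (P := fun J => fle (fmeet W J) V)).
- by move=> J J' JJ'; apply: fle_trans; apply: fmeet_mono (fle_refl _) JJ'.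
- by move=> J J'; apply: fmeet_join_le.
- move=> x; have [/UV xV|xK] := UK x; last by exists K.
  by exists V => //; apply: fmeet_r.
Qed.

(** The tube lemma. For a rectangle [rect a b] below [U], a [W] well inside [b] and a point [p i] of
    [a], compactness yields a neighbourhood [c] of [p i] with [rect c W] below [V]. The opens [c]
    cover [a] since [X] has enough points, and the opens [W] cover [b] by regularity. *)
Lemma product_enough_points (I : Type) (X : frame) (p : I -> locmap loc1 X) :
  enough_points p ->
  enough_points (fun ix : I * segment => locpair (p ix.1) (real_point ix.2)).
Proof.
move=> ep U V UV; rewrite (sup_principal U).
apply: fsup_lub => _ [[a b] Uab ->].
rewrite -[principal _]/(rect a b).
have abV i y : p i a -> real_point y b -> locpair (p i) (real_point y) V.
  move=> ia yb; apply: (UV (i, y)).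
  apply: (locmap_mono (locpair (p i) (real_point y)) (a := rect a b)).
    exact/principal_le.
  by rewrite locpair_rect.
have rect_mono (c c' : X) (d d' : II) :
    fle c c' -> fle d d' -> fle (rect c d) (rect c' d').
  by move=> cc dd; rewrite !rectE; apply: fmeet_mono; apply: locmap_mono.
suff bV : fle b (fsup (fun d => fle (rect a d) V)).
  apply: fle_trans (rect_mono _ _ _ _ (fle_refl a) bV) _.
  rewrite rectE invimage_sup; apply: fmeet_sup_le => _ [d dV ->].
  by rewrite -rectE.
apply: II_regular => W [K WK bK]; apply: fle_sup.
suff aV : fle a (fsup (fun c => fle (rect c W) V)).
  apply: fle_trans (rect_mono _ _ _ _ aV (fle_refl W)) _.
  rewrite rectE invimage_sup fmeetC; apply: fmeet_sup_le => _ [c cV ->].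
  by rewrite fmeetC -rectE.
apply: ep => i ia; rewrite invimage_sup.
suff [c ic cV] : exists2 c, p i c : Prop & fle (rect c (fmeet W ftop)) V.
  by exists (p i c) => //; exists c; rewrite ?fmeetT // in cV *.
apply: (compact_ind
  (P := fun J => exists2 c, p i c : Prop & fle (rect c (fmeet W J)) V)).
- move=> J J' JJ' [c ic cV]; exists c => //; apply: fle_trans cV.
  by apply: rect_mono; [exact: fle_refl|apply: fmeet_mono (fle_refl _) JJ'].
- move=> J J' [c ic cV] [c' ic' cV']; exists (fmeet c c').
    by rewrite invimage_meet.
  rewrite rectE [locsnd _ _ _]invimage_meet /fjoin invimage_sup fmeetA.
  apply: fmeet_sup_le => _ [_ [] -> ->]; rewrite -fmeetA -invimage_meet -rectE.
    by apply: fle_trans cV; apply: rect_mono; [exact: fmeet_l|exact: fle_refl].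
  by apply: fle_trans cV'; apply: rect_mono; [exact: fmeet_r|exact: fle_refl].
- move=> y; have [yb|yK] := bK y; last first.
    exists K => //; exists ftop; first by rewrite invimage_top.
    apply: fle_trans
      (rect_mono _ _ _ _ (fle_refl _) (WK (fsup (fun=> False)))) _.
    by rewrite rectE invimage_sup; apply: fmeet_sup_le => z [? []].
  have := abV i y ia yb.
  rewrite {1}(sup_principal V) invimage_sup => -[_ [_ [[c d] Vcd ->] ->]].
  rewrite -[principal _]/(rect c d) locpair_rect => -[ic yd].
  exists d => //; exists c => //.
  apply: fle_trans (rect_mono _ _ _ _ (fle_refl c) (fmeet_r W d)) _.
  exact/principal_le.
Qed.

Lemma real_point_midpoint (x y z : segment) :
  sval z = (sval x + sval y) / 2%:R ->
  loccomp midpoint (locpair (real_point x) (real_point y)) = real_point z.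
Proof.
move=> zE; apply: section_of_inj; rewrite section_of_midpoint.
apply: section_le_eq; [by apply: mid_sectionP; exact: section_ofP|
  exact: section_ofP|].
by apply: mid_section_le => r s; rewrite /section_of ?real_pointL ?real_pointU;
  move=> -[]; rewrite zE fmorph_div rmorphD rmorph_nat; lra.
Qed.

Lemma rat_point_real (c : rat) (hc : -1 <= c <= 1) (x : segment) :
  sval x = ratr c -> rat_point hc = real_point x.
Proof.
move=> xE; apply: locmap_classifying_ext => -[] q; rewrite classifyE.
  by rewrite real_pointL xE ltr_rat.
by rewrite real_pointU xE ltr_rat.
Qed.

(** * One-sided topologies on the line and binary expansions *)

Definition side (b : bool) (x e y : R) : bool :=
  if b then x <= y < x + e else x - e < y <= x.

(** The Sorgenfrey topology of the intervals closed on the left for [true], and its mirror image for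
    [false]. *)
Definition sided_open (b : bool) (U : R -> Prop) :=
  forall x, U x -> exists2 e, 0 < e & forall y, side b x e y -> U y.

Lemma sided_open_meet b U V : sided_open b U -> sided_open b V ->
  sided_open b (fun x => U x /\ V x).
Proof.
move=> oU oV x [/oU[e e0 eU] /oV[d d0 dV]].
exists (Num.min e d); first by rewrite lt_min e0.
move=> y xy; split; [apply: eU|apply: dV]; move: xy; rewrite /side;
  case: (b); case: (leP e d); lra.
Qed.

Lemma sided_open_sup b (S : (R -> Prop) -> Prop) :
  (forall U, S U -> sided_open b U) ->
  sided_open b (fun x => exists2 U, S U & U x).
Proof.
move=> oS x [U SU /(oS _ SU)[e e0 eU]].
by exists e => // y /eU Uy; exists U.
Qed.

Definition sided_line (b : bool) : space.
Proof.
refine (@Space R (sided_open b) _ (@sided_open_meet b) (@sided_open_sup b)).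
by move=> x _; exists 1.
Defined.

(* The first digit of x in its expansion by digits -1 and 1; the flag b
   selects one of the two expansions of a dyadic number. *)
Definition digit (b : bool) (x : R) : bool := if b then 0 <= x else 0 < x.

(** Drops the first digit: [x] is the midpoint of its digit, read as [-1] or [1], and
    [shift b x]. *)
Definition shift (b : bool) (x : R) : R :=
  if digit b x then 2%:R * x - 1 else 2%:R * x + 1.

Lemma shift_bounds b (x : R) : -1 <= x <= 1 -> -1 <= shift b x <= 1.
Proof.
by rewrite /shift /digit; case: b; [case: (leP 0 x)|case: (ltP 0 x)]; lra.
Qed.

(** The digit jumps only at [0], and the flag assigns [0] to the half-line into which the
    neighbourhoods of [side b] extend. *)
Lemma digit_locally_constant b x :
  exists2 e, 0 < e & forall y, side b x e y -> digit b y = digit b x.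
Proof.
rewrite /side /digit; have [x0|x0] := boolP (digit b x).
  exists (if b then 1 else x); first by case: b x0 => /=; lra.
  by move=> y; case: b x0 => /= x0 xy; apply/idP/idP; lra.
exists (if b then - x else 1); first by case: b x0 => /=; lra.
by move=> y; case: b x0 => /= x0 xy; apply/idP/idP; lra.
Qed.

Lemma shift_continuous b (U : R -> Prop) :
  sided_open b U -> sided_open b (fun x => U (shift b x)).
Proof.
move=> oU x /oU[e e0 eU]; have [d d0 dE] := digit_locally_constant b x.
(* Within [d] the digit is constant, so [shift] is affine there with slope [2]. *)
exists (Num.min (e / 2%:R) d); first by rewrite lt_min d0 divr_gt0.
move=> y xy; apply: eU.
have /dE yx : side b x d y.
  by move: xy; rewrite /side; case: (b); case: (leP (e / 2%:R) d); lra.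
move: xy; rewrite /side /shift yx.
by case: (digit b x); case: (b); case: (leP (e / 2%:R) d); lra.
Qed.

(** * Homomorphisms from the interval to an iterative midpoint algebra *)

Section UniversalProperty.
Variables (A : Loc) (m : product A A ~> A) (am ap : terminal ~> A).
Hypothesis mA : midpoint_algebra m.
Hypothesis itA : iterative m.

Local Notation mid p q := (m \c <| p, q |>)%cat.

Let midpp (p : terminal ~> A) : mid p p = p.
Proof. by case: mA. Qed.

Let midC (p q : terminal ~> A) : mid p q = mid q p.
Proof. by case: mA. Qed.

Let midACA (p q r s : terminal ~> A) :
  mid (mid p q) (mid r s) = mid (mid p r) (mid q s).
Proof. by case: mA. Qed.

(** Over a one-point set, both [p] and, by idempotence, [q] solve the iteration equation with
    constant head [q]. *)
Lemma mid_fixpoint (p q : terminal ~> A) : p = mid q p -> p = q.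
Proof.
move=> pE.
by apply: (iteration_point_unique itA (T := unit) (D := fun=> True)
  (h := fun=> q) (t := id) (M := fun=> p) (M' := fun=> q) _ _ _ (x := tt) I).
Qed.

Definition digit_point (b : bool) (x : R) : terminal ~> A :=
  if digit b x then ap else am.

(** Unfolded, it presents [N x] as an infinite nested midpoint of the endpoints selected by the
    digits of [x]. *)
Definition expansion_eq (b : bool) (N : R -> (terminal ~> A)) :=
  forall x, -1 <= x <= 1 -> N x = mid (digit_point b x) (N (shift b x)).

Lemma expansion_1 b N : expansion_eq b N -> N 1 = ap.
Proof.
move=> NE; apply: mid_fixpoint; rewrite {1}NE; last lra.
have d1 : digit b 1 by rewrite /digit; case: (b); lra.
by rewrite /digit_point /shift d1; congr (mid _ (N _)); lra.
Qed.

Lemma expansion_N1 b N : expansion_eq b N -> N (-1) = am.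
Proof.
move=> NE; apply: mid_fixpoint; rewrite {1}NE; last lra.
have d1 : digit b (-1) = false.
  by rewrite /digit; case: (b); apply/negbTE; lra.
by rewrite /digit_point /shift d1; congr (mid _ (N _)); lra.
Qed.

(* The two expansions differ only at 0, where both give the midpoint of the
   endpoints. *)
Lemma expansion_irrelevance b c N : expansion_eq b N -> expansion_eq c N.
Proof.
move=> NE x hx; have N1 := expansion_1 NE; have N2 := expansion_N1 NE.
have [x0|x0] := eqVneq x 0.
  have e1 : 2%:R * 0 - 1 = -1 :> R by lra.
  have e2 : 2%:R * 0 + 1 = 1 :> R by lra.
  rewrite NE // x0 /digit_point /shift /digit ltxx lexx.
  by case: (b); case: c; rewrite ?e1 ?e2 ?N1 ?N2 // midC.
have E : digit b x = digit c x.
  by rewrite /digit; case: (b); case: c; rewrite // le_eqVlt eq_sym (negbTE x0).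
by rewrite NE // /digit_point /shift E.
Qed.

Lemma expansion_unique b N N' : expansion_eq b N -> expansion_eq b N' ->
  forall x, -1 <= x <= 1 -> N x = N' x.
Proof. exact: (iteration_point_unique itA (shift_bounds b)). Qed.

Lemma expansion_exists : exists2 N : R -> (terminal ~> A),
  forall b, expansion_eq b N &
  forall (a : A) (x : R), -1 <= x <= 1 -> (N x : locmap _ _) a ->
    exists2 e : R, 0 < e & forall y : R, -1 <= y <= 1 -> x - e < y < x + e ->
      (N y : locmap _ _) a : Prop.
Proof.
have ex b : exists2 N : R -> (terminal ~> A), expansion_eq b N &
    forall a : A, sided_open b (fun x => (N x : locmap _ _) a).
  have [||N NE oN] := iteration_point_exists itA (T := sided_line b)
    (h := digit_point b) (t := shift b).
  - move=> a x ax; have [e e0 eE] := digit_locally_constant b x.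
    by exists e => // y /eE; rewrite /digit_point => ->.
  - exact: shift_continuous.
  - by exists N => // x _; apply: NE.
have [N NE oN] := ex true; have [N' N'E oN'] := ex false.
exists N => [b|a x hx Nx]; first exact: expansion_irrelevance NE.
(* The two one-sided solutions satisfy one and the same equation, so continuity of [N'] from the
   left passes to [N]. *)
have NN' := expansion_unique NE (expansion_irrelevance true N'E).
have [e e0 eN] := oN _ _ Nx.
have [d d0 dN] : exists2 e, 0 < e & forall y, side false x e y ->
    (N' y : locmap _ _) a : Prop.
  by apply: oN'; rewrite -NN'.
exists (Num.min e d) => [|y hy]; first by rewrite lt_min e0.
have [xy|yx] := leP x y.
  by case: (leP e d) => ? ?; apply: eN; rewrite /side; lra.
by rewrite NN' //; case: (leP e d) => ? ?; apply: dN; rewrite /side; lra.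
Qed.

(** * Expansions preserve midpoints *)

Section ExpansionHom.
Variable N : R -> (terminal ~> A).
Hypothesis NE : forall b, expansion_eq b N.

(** Prefixes the digit [1]. For [x = -1] the argument is [0], which has that digit under the flag
    [true]; the dual lemma takes [false]. *)
Lemma expansion_mid1 (x : R) :
  -1 <= x <= 1 -> N ((1 + x) / 2%:R) = mid ap (N x).
Proof.
move=> hx; rewrite (NE true); last lra.
have d1 : digit true ((1 + x) / 2%:R) by rewrite /digit; lra.
by rewrite /digit_point /shift d1; congr (mid _ (N _)); lra.
Qed.

Lemma expansion_midN1 (x : R) :
  -1 <= x <= 1 -> N ((x - 1) / 2%:R) = mid am (N x).
Proof.
move=> hx; rewrite (NE false); last lra.
have d1 : digit false ((x - 1) / 2%:R) = false.
  by apply/negbTE; rewrite /digit; lra.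
by rewrite /digit_point /shift d1; congr (mid _ (N _)); lra.
Qed.

(** Halving [x] is taking its midpoint with [0]. If [x] has digits [1, y], then [x / 2] has digits
    [1, -1, y], and the exchange law and idempotence identify the two nested midpoints; the negative
    case is symmetric. *)
Lemma expansion_half (x : R) :
  -1 <= x <= 1 -> N (x / 2%:R) = mid (mid am ap) (N x).
Proof.
move=> hx; have [x0|x0] := leP 0 x.
  have hy : -1 <= 2%:R * x - 1 <= 1 by lra.
  have hz : -1 <= (2%:R * x - 1 - 1) / 2%:R <= 1 by lra.
  have -> : x / 2%:R = (1 + (2%:R * x - 1 - 1) / 2%:R) / 2%:R by lra.
  have -> : N x = N ((1 + (2%:R * x - 1)) / 2%:R) by congr N; lra.
  rewrite (expansion_mid1 hz) (expansion_mid1 hy) (expansion_midN1 hy).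
  by rewrite [mid am ap]midC midACA midpp.
have hy : -1 <= 2%:R * x + 1 <= 1 by lra.
have hz : -1 <= (1 + (2%:R * x + 1)) / 2%:R <= 1 by lra.
have -> : x / 2%:R = ((1 + (2%:R * x + 1)) / 2%:R - 1) / 2%:R by lra.
have -> : N x = N ((2%:R * x + 1 - 1) / 2%:R) by congr N; lra.
rewrite (expansion_midN1 hz) (expansion_midN1 hy) (expansion_mid1 hy).
by rewrite midACA midpp.
Qed.

(** Both sides, as functions of the pair, solve the iteration equation whose head is the midpoint of
    the two first digits and whose tail shifts both coordinates. *)
Lemma expansion_mid (x y : R) : -1 <= x <= 1 -> -1 <= y <= 1 ->
  N ((x + y) / 2%:R) = mid (N x) (N y).
Proof.
move=> hx hy.
have step u v : -1 <= u <= 1 -> -1 <= v <= 1 -> N ((u + v) / 2%:R) =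
    mid (mid (digit_point true u) (digit_point true v))
      (N ((shift true u + shift true v) / 2%:R)).
  move=> /(shift_bounds true) hu /(shift_bounds true) hv.
  have hw : -1 <= (shift true u + shift true v) / 2%:R <= 1 by lra.
  (* Equal digits are prefixed to the midpoint of the tails; opposite digits cancel and leave half
     that midpoint. *)
  move: hw; rewrite /digit_point /shift; case: ifP => _; case: ifP => _ hw.
  - by rewrite midpp -expansion_mid1 //; congr N; lra.
  - by rewrite [mid ap am]midC -expansion_half //; congr N; lra.
  - by rewrite -expansion_half //; congr N; lra.
  - by rewrite midpp -expansion_midN1 //; congr N; lra.
apply: (iteration_point_unique itA (T := (R * R)%type)
  (D := fun z => -1 <= z.1 <= 1 /\ -1 <= z.2 <= 1)
  (h := fun z => mid (digit_point true z.1) (digit_point true z.2))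
  (t := fun z => (shift true z.1, shift true z.2))
  (M := fun z => N ((z.1 + z.2) / 2%:R)) (M' := fun z => mid (N z.1) (N z.2))
  _ _ _ (x := (x, y)) (conj hx hy)).
- by move=> z [h1 h2]; split; apply: shift_bounds.
- by move=> z [h1 h2]; apply: step.
- by move=> z [h1 h2]; rewrite {1}(NE true h1) {1}(NE true h2) midACA.
Qed.

End ExpansionHom.

(** Every real point is the midpoint of an endpoint and its shift, so each homomorphism satisfies
    the expansion equation at real points, and these separate maps out of [II]. *)
Lemma interval_map_unique (N N' : II ~> A) :
  midpoint_hom midpoint m N -> (N \c minus_one)%cat = am ->
  (N \c plus_one)%cat = ap ->
  midpoint_hom midpoint m N' -> (N' \c minus_one)%cat = am ->
  (N' \c plus_one)%cat = ap -> N = N'.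
Proof.
move=> homN Nm Np homN' N'm N'p.
pose tl (x : segment) := in_segment (shift_bounds true (svalP x)).
have sol (F : II ~> A) : midpoint_hom midpoint m F ->
    (F \c minus_one)%cat = am -> (F \c plus_one)%cat = ap ->
    forall x : segment, True -> (F \c (real_point x : terminal ~> II))%cat =
      mid (digit_point true (sval x))
        (F \c (real_point (tl x) : terminal ~> II))%cat.
  move=> homF Fm Fp x _.
  have step (c : rat) (hc : -1 <= c <= 1) :
      sval x = (ratr c + sval (tl x)) / 2%:R ->
      (F \c (real_point x : terminal ~> II))%cat =
      mid (F \c rat_point hc)%cat
        (F \c (real_point (tl x) : terminal ~> II))%cat.
    move=> xE; have hc' : -1 <= (ratr c : R) <= 1.
      by rewrite -(rmorph1 (@ratr R)) -rmorphN !ler_rat.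
    rewrite (rat_point_real hc (x := in_segment hc')) //.
    rewrite -product_map_pairing comp_assoc -homF -comp_assoc.
    congr (_ \c _)%cat; apply/esym.
    exact: (@real_point_midpoint (in_segment hc') (tl x)).
  rewrite /digit_point; have [d|d] := boolP (digit true (sval x)).
    rewrite -Fp; apply: step; rewrite /= /shift d rmorph1; lra.
  rewrite -Fm; apply: step; rewrite /= /shift (negbTE d) rmorphN1; lra.
apply: (enough_points_ext real_enough_points) => x.
exact: (iteration_point_unique itA (T := segment) (D := fun=> True)
  _ (sol N homN Nm Np) (sol N' homN' N'm N'p) (x := x) I).
Qed.

Lemma interval_map_exists : exists N : II ~> A,
  [/\ midpoint_hom midpoint m N, (N \c minus_one)%cat = am
    & (N \c plus_one)%cat = ap].
Proof.
have [f fE fopen] := expansion_exists.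
(* The inverse image of [a] is built from the rational intervals that [f] maps into [a]; two-sided
   continuity of [f] makes them exhaust it. *)
pose phi (a : A) : II := fsup (fun z => exists p q : rat,
  (forall y : R, -1 <= y <= 1 -> ratr p < y < ratr q ->
    (f y : locmap _ _) a : Prop)
  /\ z = fmeet (gL p) (gU q)).
have phiE (x : segment) a :
    real_point x (phi a) <-> (f (sval x) : locmap loc1 A) a.
  rewrite /phi invimage_sup; split.
    move=> [_ [_ [p [q [pqa ->]]] ->]].
    rewrite invimage_meet => -[]; rewrite real_pointL real_pointU => px xq.
    by apply: (pqa (sval x) (svalP x)); rewrite px.
  move=> /(fopen _ _ (svalP x))[e e0 ea].
  have [|p ep px] := @ratr_between (sval x - e) (sval x); first lra.
  have [|q xq qe] := @ratr_between (sval x) (sval x + e); first lra.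
  exists (real_point x (fmeet (gL p) (gU q))).
    exists (fmeet (gL p) (gU q)) => //; exists p, q; split=> // y hy pyq.
    by apply: ea => //; lra.
  by rewrite invimage_meet; split; rewrite ?real_pointL ?real_pointU.
have [N NE] := locmap_of_points (f := fun x : segment => f (sval x))
  real_enough_points phiE.
have {}NE x :
    ((N : II ~> A) \c (real_point x : terminal ~> II))%cat = f (sval x).
  exact: NE.
exists N; split.
- apply: (enough_points_ext
    (product_enough_points real_enough_points)) => -[x y].
  rewrite -[LHS]/((N : II ~> A) \c midpoint \c
    <| (real_point x : terminal ~> II), (real_point y : terminal ~> II) |>)%cat.
  rewrite -[RHS]/(m \c product_map (N : II ~> A) (N : II ~> A) \c
    <| (real_point x : terminal ~> II), (real_point y : terminal ~> II) |>)%cat.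
  rewrite -!comp_assoc product_map_pairing !NE.
  have hz : -1 <= (sval x + sval y) / 2%:R <= 1.
    by have := svalP x; have := svalP y => /= ? ?; lra.
  rewrite -(expansion_mid fE (svalP x) (svalP y)).
  rewrite -[RHS](NE (in_segment hz)).
  have E := @real_point_midpoint x y (in_segment hz) erefl.
  exact: (congr1 (fun k : terminal ~> II => (N : II ~> A) \c k)%cat E).
- have h1 : -1 <= (-1 : R) <= 1 by lra.
  have -> : minus_one = real_point (in_segment h1).
    by apply: rat_point_real; rewrite rmorphN1.
  by rewrite NE; apply: (expansion_N1 (fE true)).
- have h1 : -1 <= (1 : R) <= 1 by lra.
  have -> : plus_one = real_point (in_segment h1).
    by apply: rat_point_real; rewrite rmorph1.
  by rewrite NE; apply: (expansion_1 (fE true)).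
Qed.

End UniversalProperty.
End RealPoints.

Theorem theorem8p11 : @interval_object Loc II midpoint minus_one plus_one.
Proof.
split; first by split; [exact: II_midpoint_algebra|exact: II_iterative].
move=> A m am ap [mA itA].
(* The reals are auxiliary to the construction, so any model of them serves. *)
have [N [homN Nm Np]] := interval_map_exists Rdefinitions.R am ap mA itA.
exists N; split=> // N' [homN' N'm N'p].
exact: (interval_map_unique Rdefinitions.R itA homN Nm Np homN' N'm N'p).
Qed.
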